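(* Let $\mathcal{T}=(\mathcal{V},\mathcal{E})$ be a tree with $\mathcal{V}=\{1,\dots,d\}$, let $(\boldsymbol{\lambda},\boldsymbol{\alpha})$ be admissible parameters, and let $\boldsymbol{N}=(N_v)_{v\in\mathcal{V}}\sim\mathrm{MPMRF}(\boldsymbol{\lambda},\boldsymbol{\alpha},\mathcal{T})$. Let $X_v=\sum_{j=1}^{N_v}B_{v,j}$ for $v\in\mathcal{V}$ and $S=\sum_{v\in\mathcal{V}}X_v$, where for each $v$ the $\mathbb{N}$-valued variables $B_{v,1},B_{v,2},\dots$ are i.i.d. copies of $B_v$ with $0<\mathbb{E}[B_v]<\infty$, the sequences for different $v$ are mutually independent, and all are independent of $\boldsymbol{N}$. Fix $v\in\mathcal{V}$, let $\mathcal{T}_v$ be $\mathcal{T}$ rooted at $v$, and let $\boldsymbol{G}^{\mathcal{T}_v}=(G_w^{\mathcal{T}_v})_{w\in\mathcal{V}}$ be a random vector with joint probability generating function $\boldsymbol{t}\mapsto\eta_v^{\mathcal{T}_v}(\boldsymbol{t};\boldsymbol{\theta})$, $\boldsymbol{t}\in[-1,1]^d$, where $\boldsymbol{\theta}=(\theta_k)_{k\in\mathcal{V}\setminus\{v\}}$, $\theta_k=\alpha_{(\mathrm{pa}(k),k)}\sqrt{\lambda_k/\lambda_{\mathrm{pa}(k)}}$, parents being taken in $\mathcal{T}_v$. Let $$K^{(v)}=\sum_{i=1}^{G_v^{\mathcal{T}_v}}B^*_{v,i}+\sum_{j\in\mathcal{V}\setminus\{v\}}\ \sum_{i=1}^{G_j^{\mathcal{T}_v}}B'_{j,i},$$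 where $B^*_{v,i}$ are copies of the size-biased transform $B_v^*$ of $B_v$, i.e. $\Pr(B_v^*=x)=\frac{x}{\mathbb{E}[B_v]}\Pr(B_v=x)$, $B'_{j,i}$ are copies of $B_j$, and all the variables $B^*_{v,i}$, $B'_{j,i}$ and the vector $\boldsymbol{G}^{\mathcal{T}_v}$ are independent. Then, for every $k\in\mathbb{N}$, $$\mathbb{E}\big[X_v\mathbf{1}_{\{S=k\}}\big]=\lambda_v\,\mathbb{E}[B_v]\,\Pr\big(K^{(v)}+S=k\big),$$ where on the right-hand side $K^{(v)}$ and $S$ are taken to be independent.
   Context: Edges are undirected, so $\alpha_{(u,v)}=\alpha_{(v,u)}$. Parameters $(\boldsymbol{\lambda},\boldsymbol{\alpha})$, with $\boldsymbol{\lambda}=(\lambda_v)_{v\in\mathcal{V}}$ and $\boldsymbol{\alpha}=(\alpha_e)_{e\in\mathcal{E}}$, are admissible if $\lambda_v>0$ for all $v$ and $0<\alpha_{(u,v)}\le\min(\sqrt{\lambda_u/\lambda_v},\sqrt{\lambda_v/\lambda_u})$ for every edge $(u,v)$. Binomial thinning: for an $\mathbb{N}$-valued $Y$ and $\theta\in[0,1]$, $\theta\circ Y:=\sum_{j=1}^{Y}I_j^{(\theta)}$ with $(I_j^{(\theta)})_{j\ge1}$ i.i.d. Bernoulli($\theta$), independent of $Y$. $\boldsymbol{N}\sim\mathrm{MPMRF}(\boldsymbol{\lambda},\boldsymbol{\alpha},\mathcal{T})$ means: for a choice of root $r\in\mathcal{V}$ (the resulting law does not depend on the choice), with $\mathrm{pa}(v)$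 the parent of $v$ in $\mathcal{T}$ rooted at $r$, $N_r=L_r$ and $N_v=\big(\alpha_{(\mathrm{pa}(v),v)}\sqrt{\lambda_v/\lambda_{\mathrm{pa}(v)}}\big)\circ N_{\mathrm{pa}(v)}+L_v$ for $v\ne r$, where the $L_v$ are independent, $L_r\sim\mathrm{Poisson}(\lambda_r)$, $L_v\sim\mathrm{Poisson}\big(\lambda_v(1-\alpha_{(\mathrm{pa}(v),v)}\sqrt{\lambda_{\mathrm{pa}(v)}/\lambda_v})\big)$ for $v\neq r$, and the Bernoulli sequences used in the thinnings are mutually independent and independent of $(L_v)_{v\in\mathcal{V}}$. A Poisson distribution with parameter $0$ is the point mass at $0$; empty sums are $0$ and empty products are $1$. For a rooted tree $\mathcal{T}_r$, let $\mathrm{ch}(v)$ and $\mathrm{dsc}(v)$ denote the children and the (proper) descendants of $v$. For $\boldsymbol{t}\in[-1,1]^d$ and thinning parameters $\theta_j\in[0,1]$, the functions $\eta_v^{\mathcal{T}_r}$ are defined recursively by $$\eta_v^{\mathcal{T}_r}\big((t_j)_{j\in\{v\}\cup\mathrm{dsc}(v)};(\theta_j)_{j\in\mathrm{dsc}(v)}\big)=t_v\prod_{j\in\mathrm{ch}(v)}\Big(1-\theta_j+\theta_j\,\eta_j^{\mathcal{T}_r}\big((t_i)_{i\in\{j\}\cup\mathrm{dsc}(j)};(\theta_i)_{i\in\mathrm{dsc}(j)}\big)\Big),$$ so that $\eta_v^{\mathcal{T}_r}=t_v$ when $v$ has no children. These are joint probability generating functions of $\mathbb{N}$-valued random vectors.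 *)

(* Defs.v *)
From HB Require Import structures.
From mathcomp Require Import all_boot all_order all_algebra.
From mathcomp Require Import all_classical all_reals all_analysis.
From mathcomp Require Import zify.

Set Implicit Arguments.
Unset Strict Implicit.
Unset Printing Implicit Defensive.

Import Order.TTheory GRing.Theory Num.Theory.

Local Open Scope classical_set_scope.
Local Open Scope ring_scope.

Section trees.
Variables (V : finType) (e : rel V).

(* [ucycle e c] also holds of the back-and-forth walk [:: u; v] along an edge,
   hence the bound 2 rather than 0. *)
Definition is_tree : Prop :=
  [/\ symmetric e, irreflexive e, forall u v, connect e u v
    & forall c, ucycle e c -> (size c <= 2)%N].

(* [u] is the last vertex before [w] on the simple path from the root [r] to
   [w]; the root itself has no parent. The children of [u] are the [w] such
   that [is_parent r u w]. *)
Definition is_parent (r u w : V) : bool :=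
  `[< exists p, [/\ path e r (rcons p w), uniq (r :: rcons p w)
                  & last r p = u] >].

(* The default value is only reached at the root. *)
Definition parent (r w : V) : V := odflt w [pick u | is_parent r u w].

Lemma tree_path_inj (x : V) (p q : seq V) :
  is_tree -> path e x p -> path e x q -> uniq (x :: p) -> uniq (x :: q) ->
  last x p = last x q -> p = q.
Proof.
move=> [esym _ _ eac]; elim: p x q => [|a p IH] x [|b q] //.
- by move=> _ _ _ /= /andP[/negP xq _] xl; case: xq; rewrite xl mem_last.
- by move=> _ _ /= /andP[/negP xp _] _ xl; case: xp; rewrite -xl mem_last.
have [<-|ab] := eqVneq a b.
  move=> /= /andP[_ pp] /andP[_ pq] /andP[_ up] /andP[_ uq] l.
  by rewrite (IH a q).
have hP : head x (a :: p) = a by [].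
have hQ : head x (b :: q) = b by [].
move: (a :: p) (b :: q) hP hQ (isT : a :: p != [::]) (isT : b :: q != [::]) => {IH}P Q /=.
move=> hP hQ P0 Q0 pP pQ /andP[xP uP] /andP[xQ uQ] lPQ.
have hasQ : has (mem P) Q.
  apply/hasP; exists (last x Q).
    by case: (Q) Q0 => //= c s _; apply: mem_last.
  by rewrite -lPQ; case: (P) P0 => //= c s _; apply: mem_last.
case: (split_find hasQ) uQ xQ pQ hQ => z q1 q2 zP nq1 uQ xQ pQ hQ.
case: (splitPr zP) uP xP pP hP nq1 => p1 p2 uP xP pP hP nq1.
exfalso.
have : ((size (x :: p1 ++ z :: rev q1)) <= 2)%N.
  apply: eac; rewrite /ucycle; apply/andP; split.
    rewrite /= rcons_cat /= cat_path /= -rev_cons.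
    move: pP pQ; rewrite !cat_path rcons_path /= => /and3P[-> -> _] /andP[/andP[pq1 ez] _] /=.
    move: (rev_path e x (rcons q1 z)); rewrite last_rcons belast_rcons => ->.
    rewrite (eq_path (e' := e)); last by move=> ? ?; rewrite esym.
    by rewrite rcons_path pq1.
  move: uP uQ xP xQ nq1.
  rewrite /= !cat_uniq !mem_cat !inE !mem_rcons !inE /= mem_rev !rcons_uniq rev_uniq has_rev => h1 h2 h3 h4 h5.
  rewrite !negb_or; move/and4P: h1 => [-> /norP[-> _] _ _]; move/and3P: h2 => [/andP[zq ->] _ _].
  move: h3 h4; rewrite !negb_or => /and3P[-> -> _] /andP[/andP[_ ->] _] /=.
  rewrite mem_rev zq !andbT; apply: contra h5 => /hasP[y yq yp].
  by apply/hasP; exists y => //=; rewrite mem_cat; apply/orP; left.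
rewrite /= size_cat /= size_rev => H.
case: p1 hP H {xP uP pP nq1 zP} => [|? ?] hP /= H; last by lia.
case: q1 hQ H {xQ uQ pQ} => [|? ?] hQ /= H; last by lia.
by move: ab hP hQ => /= /eqP ab hP hQ; case: ab; rewrite -hP -hQ.

Qed.

End trees.

Section eta_pgf.
Variables (R : pzRingType) (V : finType) (e : rel V) (r : V).
Variables (theta t : V -> R).

Fixpoint eta_pgf_rec (n : nat) (w : V) : R :=
  if n is n'.+1 then
    t w * \prod_(j | is_parent e r w j)
             (1 - theta j + theta j * eta_pgf_rec n' j)
  else t w.

(* A simple path has at most [#|V|] vertices, so that unfolding [#|V|] times
   reaches the leaves: on a tree, [eta_pgf] satisfies the recursion [eta_pgfE]. *)
Definition eta_pgf (w : V) : R := eta_pgf_rec #|V| w.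

Lemma eta_pgfE (w : V) : is_tree e ->
  eta_pgf w = t w * \prod_(j | is_parent e r w j)
                      (1 - theta j + theta j * eta_pgf j).
Proof.
move=> te.
have stab n u p : path e r p -> uniq (r :: p) -> last r p = u ->
    (#|V| <= n + size p)%N -> eta_pgf_rec n.+1 u = eta_pgf_rec n u.
  elim: n u p => [|n IH] u p pp up lp Vn.
    by have := max_card [in r :: p]; rewrite (card_uniqP up) /= leqNgt ltnS Vn.
  have -> : eta_pgf_rec n.+1 u = t u *
    \prod_(j | is_parent e r u j)
      (1 - theta j + theta j * eta_pgf_rec n j) by [].
  rewrite [LHS]/=; congr (_ * _); apply: eq_bigr => j /asboolP[p' [pp' up' lp']].
  rewrite -/(eta_pgf_rec n.+1 j); congr (_ + _ * _); apply: (IH j _ pp' up').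
    by rewrite last_rcons.
  have pp'r : path e r p' by move: pp'; rewrite rcons_path => /andP[].
  have up'r : uniq (r :: p').
    by move: up'; rewrite -rcons_cons rcons_uniq => /andP[].
  have <- : p = p' by apply: tree_path_inj te pp pp'r up up'r _; rewrite lp.
  by rewrite size_rcons addnS.
rewrite /eta_pgf; have [_ _ /(_ r w)/connectP[p0 pp0 w0] _] := te.
case: (shortenP pp0) w0 => p pp up _ w0.
by rewrite -(stab _ w p) ?leq_addr.
Qed.

End eta_pgf.

Section independence.
Context {disp : measure_display} {T : measurableType disp} {R : realType}.
Variable P : probability T R.

Definition mutually_independent (I : eqType) (D : set I)
    (F : I -> set (set T)) : Prop :=
  forall (J : seq I) (A : I -> set T), uniq J ->
    (forall i, i \in J -> D i /\ F i (A i)) ->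
    P (\bigcap_(i in [set` J]) A i) = (\prod_(i <- J) P (A i))%E.

End independence.

Section generated.
Context {disp disp' : measure_display}.
Context {T : measurableType disp} {E : measurableType disp'}.

Definition sigma_var (X : T -> E) : set (set T) :=
  preimage_set_system setT X measurable.

Definition sigma_vect (I : Type) (X : I -> T -> E) : set (set T) :=
  <<s \bigcup_i sigma_var (X i) >>.

End generated.

Definition random_sum (n : nat) (f : nat -> nat) : nat := (\sum_(i < n) f i)%N.

Definition thinning (I : nat -> bool) (n : nat) : nat :=
  random_sum n (fun j => nat_of_bool (I j)).

Section mpmrf.
Context {R : realType} {V : finType}.
Variables (e : rel V) (lam : V -> R) (alpha : V -> V -> R).

(* [alpha] is indexed by ordered pairs; its values off the edges are never
   used. *)
Definition admissible : Prop :=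
  [/\ forall w, 0 < lam w,
      forall u w, e u w -> alpha u w = alpha w u
    & forall u w, e u w ->
        0 < alpha u w <= Num.min (Num.sqrt (lam u / lam w))
                                 (Num.sqrt (lam w / lam u))].

Definition thinning_prob (r w : V) : R :=
  alpha (parent e r w) w * Num.sqrt (lam w / lam (parent e r w)).

Definition innovation_rate (r w : V) : R :=
  if w == r then lam r
  else lam w * (1 - alpha (parent e r w) w
                      * Num.sqrt (lam (parent e r w) / lam w)).

(* [poisson_prob a k] does not depend on [k], and is the Dirac mass at 0 when
   [a = 0]. No thinning takes place at the root, hence the exclusion of the
   sequence [I r]. *)
Record mpmrf_construction (r : V) disp (T : measurableType disp)
    (P : probability T R) (L : V -> {RV P >-> nat})
    (I : V -> nat -> {RV P >-> bool}) (M : V -> {RV P >-> nat}) : Prop := {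
  mpmrf_root : forall x, M r x = L r x;
  mpmrf_step : forall w x, w != r ->
    M w x = (thinning (fun j => I w j x) (M (parent e r w) x) + L w x)%N;
  mpmrf_poisson : forall w,
    distribution P (L w) =1 poisson_prob (innovation_rate r w) 0;
  mpmrf_bernoulli : forall w j, w != r ->
    distribution P (I w j) =1 bernoulli_prob (thinning_prob r w);
  mpmrf_independent :
    mutually_independent P
      [set i : V + V * nat | if i is inr (w, _) then w != r else true]
      (fun i => match i with
                | inl w => sigma_var (L w)
                | inr (w, j) => sigma_var (I w j)
                end)
}.

(* [N] has the law of the construction for some root, possibly carried out on
   another probability space. *)
Definition is_mpmrf disp (T : measurableType disp) (P : probability T R)
    (N : V -> {RV P >-> nat}) : Prop :=
  exists (r : V) (disp' : measure_display) (T' : measurableType disp')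
    (P' : probability T' R) (L : V -> {RV P' >-> nat})
    (I : V -> nat -> {RV P' >-> bool}) (M : V -> {RV P' >-> nat}),
    mpmrf_construction r L I M /\
    forall A : set (V -> nat),
      P [set x | A (fun w => N w x)] = P' [set x | A (fun w => M w x)].

End mpmrf.

Section compound.
Context {R : realType} {V : finType}.

Definition compound {T : Type} (N : V -> T -> nat) (B : V -> nat -> T -> nat)
  (w : V) (x : T) : nat := random_sum (N w x) (fun i => B w i x).

Definition aggregate {T : Type} (N : V -> T -> nat) (B : V -> nat -> T -> nat)
  (x : T) : nat := (\sum_w compound N B w x)%N.

Definition allocation {T : Type} (v : V) (G : V -> T -> nat)
    (Bstar : nat -> T -> nat) (B' : V -> nat -> T -> nat) (x : T) : nat :=
  (random_sum (G v x) (fun i => Bstar i x)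
   + \sum_(j | j != v) random_sum (G j x) (fun i => B' j i x))%N.

Definition joint_pgf disp (T : measurableType disp) (P : probability T R)
    (G : V -> {RV P >-> nat}) (t : V -> R) : \bar R :=
  'E_P[fun x => \prod_w t w ^+ G w x].

Definition law_mean (mu : probability nat R) : \bar R := 'E_mu[fun x => x%:R].

Definition size_biased (mu : probability nat R) (nu : set nat -> \bar R) : Prop :=
  forall x, nu [set x] = ((x%:R / fine (law_mean mu))%:E * mu [set x])%E.

End compound.

(* Main.v *)
(** Both sides are compared through their generating functions in [s].
    Conditionally on [N] the claims are independent, so that
    [E[s^S] = P_N(b)] and [E[X_v s^S] = E[B_v s^B_v] (d P_N / d t_v)(b)], where
    [P_N] is the joint generating function of [N] and [b_w = E[s^B_w]].
    Peeling the vertices off the tree, deepest first, gives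
    [P_N(t) = exp (sum_w rate_w (eta_w(t) - 1))] for the root of the
    construction, and the exponent is unchanged when the root moves along an
    edge. Rooted at [v], only the term of [v] involves [t_v], and it is linear
    in [t_v]; hence [t_v d P_N / d t_v = lam_v eta_v P_N], which is read off the
    coefficients of an exponential series rather than by differentiating under
    the expectation. Finally [eta_v], evaluated at the generating functions of
    [B*_v] and of the [B_j], is that of the allocation [K]. *)
Require Import Defs.
From HB Require Import structures.
From mathcomp Require Import all_boot all_order all_algebra.
From mathcomp Require Import all_classical all_reals all_analysis.
From mathcomp Require Import measurable_realfun.
From mathcomp Require Import ring.

Set Implicit Arguments.
Unset Strict Implicit.
Unset Printing Implicit Defensive.

Import Order.TTheory GRing.Theory Num.Theory.

Local Open Scope classical_set_scope.
Local Open Scope ring_scope.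

(** * Discrete random variables *)

(** All integrands are nonnegative and all conditioning variables take countably many values, a
    family of counts being one variable in [{ffun V -> nat}]. Conditional expectations are thereby
    replaced by sums over fibres. Finiteness matters above all when coefficients are compared:
    equality of the generating functions on (0, 1] determines the coefficients once they are
    nonnegative and summable, and the masses E[X_v; S = j] are summable because E[B_v], hence
    E[X_v], is finite.

    Rerooting is unavoidable: the root in the definition of the field is existentially quantified,
    whereas K is built from the tree rooted at v. Invariance is computed across one edge, where the
    exponent takes a form symmetric in the two ends, and connectedness carries it to any root.

    Size biasing fills a gap left by the derivative. Taking it in t_v removes the factor t_v from
    eta_v; the claim singled out by X_v brings E[B_v s^B_v], which is E[B_v] times the generating
    function of the size-biased claim, and this last function stands where t_v was. Hence the claims
    of v, and only those, are size-biased in K. *)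

Section discrete_measurability.
Context d (T : measurableType d).

Lemma measurable_fun_nat d' (E : measurableType d') (f : nat -> E) :
  measurable_fun setT f.
Proof. by []. Qed.

(** Splitting the preimage along the countably many values of [M] handles a random index, such as
    the length of a random sum. *)
Lemma measurable_fun_select d' (E : measurableType d') (M : T -> nat)
    (h : nat -> T -> E) :
  measurable_fun setT M -> (forall n, measurable_fun setT (h n)) ->
  measurable_fun setT (fun x => h (M x) x).
Proof.
move=> mM mh _ A mA; rewrite setTI.
rewrite (_ : _ @^-1` A = \bigcup_n (M @^-1` [set n] `&` h n @^-1` A)).
  apply: bigcup_measurable => n _; apply: measurableI.
    by rewrite -[X in measurable X]setTI; exact: mM.
  by rewrite -[X in measurable X]setTI; exact: mh.
by apply/seteqP; split=> [x hx|x [n _ []] /= <- //]; exists (M x).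
Qed.

Lemma measurable_fun_sumn (I : Type) (r : seq I) (Q : pred I)
    (f : I -> T -> nat) :
  (forall i, measurable_fun setT (f i)) ->
  measurable_fun setT (fun x => \sum_(i <- r | Q i) f i x)%N.
Proof.
move=> mf; elim: r => [|i r IH].
  by under eq_fun do rewrite big_nil; exact: measurable_cst.
under eq_fun do rewrite big_cons; case: (Q i) => //.
exact: measurable_fun_addn.
Qed.

Lemma measurable_fun_random_sum (M : T -> nat) (f : nat -> T -> nat) :
  measurable_fun setT M -> (forall i, measurable_fun setT (f i)) ->
  measurable_fun setT (fun x => random_sum (M x) (f^~ x)).
Proof.
move=> mM mf.
apply: (measurable_fun_select (h := fun n x => random_sum n (f^~ x))) => // n.
exact: measurable_fun_sumn.
Qed.

Lemma measurable_preimage d' (E : measurableType d') (f : T -> E) (A : set E) :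
  measurable_fun setT f -> measurable A -> measurable (f @^-1` A).
Proof. by move=> mf mA; rewrite -[X in measurable X]setTI; exact: mf. Qed.

(** [{ffun V -> nat}] replaces [V -> nat] because it is countable, so that its fibres can be summed
    over. The measurable type is arbitrary: generated sigma-algebras are also substituted for it, to
    place the fibres among the events that some chosen variables determine. *)
Lemma measurable_fiber (V : finType) (Y : V -> T -> nat) (y : {ffun V -> nat}) :
  (forall w, measurable_fun setT (Y w)) ->
  measurable [set x | [ffun w => Y w x] = y].
Proof.
move=> mY.
rewrite (_ : [set _ | _] =
  \big[setI/setT]_(w <- enum V) (Y w @^-1` [set y w])).
  by apply: bigsetI_measurable => w _; apply: measurable_preimage.
rewrite -bigcap_seq; apply/seteqP; split => x /=.
  by move=> <- w _ /=; rewrite ffunE.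
move=> h; apply/ffunP => w; rewrite ffunE; apply: h => /=.
exact: mem_enum.
Qed.

Lemma measurable_comp_nat (R : realType) (Y : T -> nat) (f : nat -> R) :
  measurable_fun setT Y -> measurable_fun setT (fun x => f (Y x)).
Proof. exact: (measurableT_comp (measurable_fun_nat f)). Qed.

Lemma measurable_prod_cond (R : realType) (I : Type) (r : seq I) (Q : pred I)
    (f : I -> T -> R) :
  (forall i, measurable_fun setT (f i)) ->
  measurable_fun setT (fun x => \prod_(i <- r | Q i) f i x).
Proof.
move=> mf; elim: r => [|i r IH].
  by under eq_fun do rewrite big_nil; exact: measurable_cst.
under eq_fun do rewrite big_cons; case: (Q i) => //.
exact: measurable_funM.
Qed.

End discrete_measurability.

(** * Integration along the fibres of a countable variable *)

Section fibers.
Local Open Scope ereal_scope.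
Context (R : realType) (K : countType).

(** The codes [pickle (Y x)] index the partition by [nat]; a number that codes no value of [Y]
    contributes an empty fibre. *)
Lemma integral_fibers d (T : measurableType d) (P : {measure set T -> \bar R})
    (Y : T -> K) (C : set T) (h : T -> \bar R) :
  measurable C -> (forall y, measurable (Y @^-1` [set y])) ->
  measurable_fun C h -> (forall x, C x -> 0 <= h x) ->
  \int[P]_(x in C) h x =
    \sum_(n <oo) \int[P]_(x in C `&` [set x | pickle (Y x) = n]) h x.
Proof.
move=> mC mY mh h0.
have CE : C = \bigcup_n (C `&` [set x | pickle (Y x) = n]).
  rewrite -setI_bigcupr; apply/seteqP; split=> [x Cx|x []//].
  by split=> //; exists (pickle (Y x)).
rewrite {1}CE; apply: ge0_integral_bigcup.
- move=> n; apply: measurableI => //.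
  have [[y yn]|ny] := pselect (exists y : K, pickle y = n).
    rewrite (_ : [set _ | _] = Y @^-1` [set y])//.
    by apply/seteqP; split => x /=; rewrite -yn; [exact: (pcan_inj pickleK)|move=> ->].
  rewrite (_ : [set _ | _] = set0)//.
  by apply/seteqP; split => x //= xn; apply: ny; exists (Y x).
- by rewrite -CE.
- by rewrite -CE.
- by move=> i j _ _ [x [[_ /= <-] [_ /= <-]]].
Qed.

(** This plays the role of conditioning on a discrete variable: a factor [c] common to all fibres is
    a factor of the integrals. The two sides may live on different spaces, which also allows laws to
    be transported. *)
Lemma integral_fibers_proportional d1 (T1 : measurableType d1)
    (P1 : {measure set T1 -> \bar R}) d2 (T2 : measurableType d2)
    (P2 : {measure set T2 -> \bar R}) (Y1 : T1 -> K) (Y2 : T2 -> K)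
    (C1 : set T1) (C2 : set T2) (h1 : T1 -> \bar R) (h2 : T2 -> \bar R) (c : R) :
  measurable C1 -> (forall y, measurable (Y1 @^-1` [set y])) ->
  measurable_fun C1 h1 -> (forall x, C1 x -> 0 <= h1 x) ->
  measurable C2 -> (forall y, measurable (Y2 @^-1` [set y])) ->
  measurable_fun C2 h2 -> (forall x, C2 x -> 0 <= h2 x) ->
  (forall y, \int[P1]_(x in C1 `&` [set x | Y1 x = y]) h1 x =
             c%:E * \int[P2]_(x in C2 `&` [set x | Y2 x = y]) h2 x) ->
  \int[P1]_(x in C1) h1 x = c%:E * \int[P2]_(x in C2) h2 x.
Proof.
move=> mC1 mY1 mh1 h10 mC2 mY2 mh2 h20 H.
rewrite (integral_fibers P1 mC1 mY1)// (integral_fibers P2 mC2 mY2)// -nneseriesZl.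
  apply: eq_eseriesr => n _.
  have [[y yn]|ny] := pselect (exists y : K, pickle y = n).
    have E (S : Type) (Y : S -> K) : [set x | pickle (Y x) = n] = [set x | Y x = y].
      apply/seteqP; split => x /=; rewrite -yn; last by move=> ->.
      exact: (pcan_inj pickleK).
    by rewrite !E.
  have E (S : Type) (Y : S -> K) : [set x | pickle (Y x) = n] = set0.
    by apply/seteqP; split => x //= xn; apply: ny; exists (Y x).
  by rewrite !E !setI0 !integral_set0 mule0.
by move=> n _; apply: integral_ge0 => x [Cx _]; exact: h20.
Qed.

End fibers.

Section products.
Local Open Scope ereal_scope.
Context (R : realType) d (T : measurableType d) (P : probability T R).

(** The event [C] makes the induction on [J] work: its intersection with a level set of [Y i] takes
    over its role for the remaining variables, and [f i (Y i x)] is constant there. *)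
Lemma integral_prod_independent (I : eqType) (J : seq I) (Y : I -> T -> nat)
    (f : I -> nat -> R) (C : set T) :
  measurable C -> (forall i, measurable_fun setT (Y i)) -> uniq J ->
  (forall i n, (0 <= f i n)%R) ->
  (forall i, i \in J -> \int[P]_x (f i (Y i x))%:E < +oo) ->
  (forall D : I -> set nat,
     P (C `&` \bigcap_(i in [set` J]) Y i @^-1` D i) =
     P C * \prod_(i <- J) P (Y i @^-1` D i)) ->
  \int[P]_(x in C) (\prod_(i <- J) f i (Y i x))%:E =
    P C * \prod_(i <- J) \int[P]_x (f i (Y i x))%:E.
Proof.
move=> mC mY; elim: J C mC => [|i J IH] C mC uJ f0 foo ind.
  rewrite big_nil mule1; under eq_integral do rewrite big_nil.
  by rewrite integral_cst// mul1e.
have [iJ uJ'] := andP uJ.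
have mprod D : measurable_fun D (fun x => (\prod_(k <- J) f k (Y k x))%:E).
  apply: measurable_funTS; apply/measurable_EFinP; apply: measurable_prod => k _.
  exact: measurable_comp_nat.
have prod0 x : (0 <= \prod_(k <- J) f k (Y k x))%R by apply: prodr_ge0.
have mfi D : measurable_fun D (fun x => (f i (Y i x))%:E).
  by apply: measurable_funTS; apply/measurable_EFinP; exact: measurable_comp_nat.
have step n D :
    P ((C `&` Y i @^-1` [set n]) `&` \bigcap_(k in [set` J]) Y k @^-1` D k) =
    P C * (P (Y i @^-1` [set n]) * \prod_(k <- J) P (Y k @^-1` D k)).
  (* Putting [[set n]] at [i], which is not in [J], shows that the smaller event is still
     independent of the remaining variables. *)
  pose D' k := if k == i then [set n] else D k.
  have DD' k : k \in J -> D' k = D k.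
    by move=> kJ; rewrite /D'; case: eqP => // ki; rewrite -ki kJ in iJ.
  have := ind D'; rewrite big_cons {2}/D' eqxx.
  rewrite (eq_big_seq (fun k => P (Y k @^-1` D k))) => [<-|k kJ]; last first.
    by rewrite DD'.
  congr (P _); apply/seteqP; split => x /=.
    move=> [[Cx Yx] h]; split => // k /=; rewrite inE => /predU1P[->|kJ].
      by rewrite /D' eqxx.
    by rewrite DD'//; exact: h.
  move=> [Cx h]; split.
    by split=> //; have := h i; rewrite /= inE eqxx /D' eqxx; apply.
  by move=> k /= kJ; rewrite -DD'//; apply: h; rewrite /= inE kJ orbT.
have stepn n : P (C `&` Y i @^-1` [set n]) = P C * P (Y i @^-1` [set n]).
  have := step n (fun=> setT).
  rewrite (_ : \bigcap_(k in _) _ = setT) ?setIT => [->|]; last first.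
    by apply/seteqP; split.
  by rewrite big1 ?mule1// => k _; rewrite preimage_setT probability_setT.
have mYn n : measurable (Y i @^-1` [set n]) by apply: measurable_preimage.
rewrite big_cons.
set p := \prod_(k <- J) _.
have p0 : 0 <= p.
  by apply: prode_ge0 => k _; apply: integral_ge0 => x _; rewrite lee_fin.
have pfin : p \is a fin_num.
  rewrite /p big_seq; apply: (big_ind (fun z => z \is a fin_num)) => //.
    by move=> ? ?; exact: fin_numM.
  move=> k kJ; rewrite ge0_fin_numE; first by apply: foo; rewrite inE kJ orbT.
  by apply: integral_ge0 => x _; rewrite lee_fin.
have PCfin : P C \is a fin_num by rewrite fin_num_measure.
rewrite [X in _ = P C * X]muleC muleA -(fineK pfin) -(fineK PCfin) -EFinM.
under eq_integral do rewrite big_cons.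
apply: (integral_fibers_proportional (Y1 := Y i) (Y2 := Y i)) => //.
- under eq_fun do rewrite EFinM; exact: emeasurable_funM.
- by move=> x _; rewrite lee_fin mulr_ge0.
- by move=> x _; rewrite lee_fin.
- move=> n; rewrite setTI.
  transitivity ((f i n)%:E * (P (C `&` Y i @^-1` [set n]) * p)).
    rewrite -IH//.
    + rewrite -ge0_integralZl//=.
      * apply: eq_integral => x; rewrite inE => -[_ /= ->].
        by rewrite EFinM.
      * exact: measurableI.
      * by move=> x _; rewrite lee_fin.
      * by rewrite lee_fin.
    + exact: measurableI.
    + by move=> k kJ; apply: foo; rewrite inE kJ orbT.
    + by move=> D; rewrite step stepn muleA.
  transitivity ((f i n)%:E * P (Y i @^-1` [set n]) * (P C * p)).
    by rewrite stepn [P C * _]muleC -!muleA.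
  rewrite EFinM (fineK pfin) (fineK PCfin) muleC; congr (_ * _).
  rewrite -integral_cst//; apply: eq_integral => x; rewrite inE => /= ->.
  by [].
Qed.

End products.

(** * Generating functions *)

Section generating_functions.
Local Open Scope ereal_scope.
Context (R : realType).
Implicit Types a b : nat -> R.

Lemma nneseries_head_shift a (s : R) : (forall k, (0 <= a k)%R) -> (0 <= s)%R ->
  \sum_(k <oo) (a k * s ^+ k)%:E =
    (a 0%N)%:E + s%:E * \sum_(k <oo) (a k.+1 * s ^+ k)%:E.
Proof.
move=> a0 s0; have u0 k : 0 <= (a k * s ^+ k)%:E by rewrite lee_fin mulr_ge0 ?exprn_ge0.
rewrite nneseries_recl// expr0 mulr1 -nneseries_addn// -nneseriesZl.
  congr (_ + _); apply: eq_eseriesr => k _.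
  by rewrite addn1 -EFinM exprS; congr EFin; ring.
by move=> k _; rewrite lee_fin mulr_ge0 ?exprn_ge0.
Qed.

Lemma nneseries_pgf_le a (s : R) : (forall k, (0 <= a k)%R) -> (0 <= s <= 1)%R ->
  \sum_(k <oo) (a k * s ^+ k)%:E <= \sum_(k <oo) (a k)%:E.
Proof.
move=> a0 /andP[s0 s1]; apply: lee_nneseries => [k _ _|k _].
  by rewrite lee_fin mulr_ge0 ?exprn_ge0.
by rewrite lee_fin ler_piMr// exprn_ile1.
Qed.

(** Small [s] isolates the heads: [b 0] is at most the common value of the series, which is at most
    [a 0 + s * A] with [A] the total mass of [a]. *)
Lemma pgf_inj_head a b : (forall k, (0 <= a k)%R) -> (forall k, (0 <= b k)%R) ->
  \sum_(k <oo) (a k)%:E < +oo ->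
  (forall s : R, (0 < s <= 1)%R ->
     \sum_(k <oo) (a k * s ^+ k)%:E = \sum_(k <oo) (b k * s ^+ k)%:E) ->
  (b 0%N <= a 0%N)%R.
Proof.
move=> a0 b0 afin ab.
have A0 : 0 <= \sum_(k <oo) (a k)%:E by apply: nneseries_ge0 => k _ _; rewrite lee_fin.
apply/ler_addgt0Pr => eps eps0.
pose A := fine (\sum_(k <oo) (a k)%:E).
have AE : \sum_(k <oo) (a k)%:E = A%:E by rewrite fineK// ge0_fin_numE.
have A0' : (0 <= A)%R by rewrite -lee_fin -AE.
(* This choice gives both [s <= 1] and [s * A <= eps], also when [A] is 0. *)
pose s := (eps / (A + eps))%R.
have s0 : (0 < s)%R by rewrite divr_gt0// ltr_wpDl.
have s1 : (s <= 1)%R by rewrite ler_pdivrMr ?ltr_wpDl// mul1r lerDr.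
have s01 : (0 < s <= 1)%R by rewrite s0.
have sA : (s * A <= eps)%R.
  by rewrite mulrAC ler_pdivrMr ?ltr_wpDl// ler_pM2l// lerDl ltW.
rewrite -lee_fin; apply: (@le_trans _ _ (\sum_(k <oo) (b k * s ^+ k)%:E)).
  rewrite nneseries_head_shift ?(ltW s0)// leeDl// mule_ge0 ?lee_fin ?(ltW s0)//.
  by apply: nneseries_ge0 => k _ _; rewrite lee_fin mulr_ge0 ?exprn_ge0 ?(ltW s0).
rewrite -ab// nneseries_head_shift ?(ltW s0)// EFinD leeD2l//.
apply: (@le_trans _ _ (s * A)%:E); last by rewrite lee_fin.
rewrite [leRHS]EFinM -AE lee_pmul2l ?lte_fin//.
apply: (@le_trans _ _ (\sum_(k <oo) (a k.+1)%:E)).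
  by apply: nneseries_pgf_le => //; rewrite (ltW s0).
rewrite [leRHS]nneseries_recl//; last by move=> k _; rewrite lee_fin.
rewrite -[X in _ <= _ + X]nneseries_addn; last by move=> k; rewrite lee_fin.
by under [X in _ <= _ + X]eq_eseriesr do rewrite addn1; rewrite leeDr// lee_fin.
Qed.

(** Once the heads agree they are subtracted and the rest is divided by [s], which leaves the same
    problem for the shifted sequences; this is where [0 < s] enters. *)
Lemma pgf_inj a b : (forall k, (0 <= a k)%R) -> (forall k, (0 <= b k)%R) ->
  \sum_(k <oo) (a k)%:E < +oo ->
  (forall s : R, (0 < s <= 1)%R ->
     \sum_(k <oo) (a k * s ^+ k)%:E = \sum_(k <oo) (b k * s ^+ k)%:E) ->
  a =1 b.
Proof.
move=> a0 b0 afin ab n; elim: n a b a0 b0 afin ab => [|n IH] a b a0 b0 afin ab.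
  apply/eqP; rewrite eq_le (pgf_inj_head a0 b0)// andbT.
  apply: pgf_inj_head => // [|s s01]; last by rewrite ab.
  (* The identity at [s = 1] gives [b] the same total mass as [a], hence a finite one, so that the
     two sequences can be exchanged. *)
  have := ab 1%R; rewrite ltr01 lexx => /(_ isT).
  under eq_eseriesr do rewrite expr1n mulr1.
  by under [RHS]eq_eseriesr do rewrite expr1n mulr1; move=> <-.
have ab0 : a 0%N = b 0%N.
  apply/eqP; rewrite eq_le (pgf_inj_head a0 b0)// andbT.
  apply: pgf_inj_head => // [|s s01]; last by rewrite ab.
  have := ab 1%R; rewrite ltr01 lexx => /(_ isT).
  under eq_eseriesr do rewrite expr1n mulr1.
  by under [RHS]eq_eseriesr do rewrite expr1n mulr1; move=> <-.
apply: (IH (fun k => a k.+1) (fun k => b k.+1)) => //.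
  apply: le_lt_trans afin.
  rewrite [leRHS]nneseries_recl//; last by move=> k _; rewrite lee_fin.
  rewrite -[X in _ <= _ + X]nneseries_addn; last by move=> k; rewrite lee_fin.
  by under [X in _ <= _ + X]eq_eseriesr do rewrite addn1; rewrite leeDr// lee_fin.
move=> s s01; have /andP[s0 s1] := s01.
have := ab s s01.
rewrite (nneseries_head_shift a0 (ltW s0)) (nneseries_head_shift b0 (ltW s0)) ab0.
rewrite addeC [RHS]addeC => /(congr1 (fun x => x - (b 0%N)%:E)).
rewrite !addeK// => /(congr1 (fun x => s^-1%:E * x)).
rewrite !muleA -!EFinM mulVf ?gt_eqF//.
by rewrite !mul1e.
Qed.

(** For [phi k = s ^+ k] this is a power series in [s] whose coefficients are the masses of the
    weight [W] on the level sets of [Z], the form to which [pgf_inj] applies. *)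
Lemma integral_level_sets d (T : measurableType d)
    (P : {measure set T -> \bar R}) (W : T -> R) (Z : T -> nat) (phi : nat -> R) :
  measurable_fun setT W -> (forall x, (0 <= W x)%R) -> measurable_fun setT Z ->
  (forall k, (0 <= phi k)%R) ->
  \int[P]_x (W x * phi (Z x))%:E =
    \sum_(k <oo) ((phi k)%:E * \int[P]_(x in [set x | Z x = k]) (W x)%:E).
Proof.
move=> mW W0 mZ phi0.
have mZk k : measurable [set x | Z x = k].
  by apply: (@measurable_preimage _ _ _ _ Z [set k]).
rewrite (_ : setT = \bigcup_k [set x | Z x = k]); last first.
  by apply/seteqP; split=> // x _; exists (Z x).
rewrite ge0_integral_bigcup//.
- apply: eq_eseriesr => k _; rewrite -ge0_integralZl//.
  + by apply: eq_integral => x; rewrite inE => /= ->; rewrite EFinM muleC.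
  + by apply: measurable_funTS; exact/measurable_EFinP.
  + by move=> x _; rewrite lee_fin.
  + by rewrite lee_fin.
- apply: measurable_funTS; apply/measurable_EFinP; apply: measurable_funM => //.
  exact: measurable_comp_nat.
- by move=> x _; rewrite lee_fin mulr_ge0.
- by move=> i j _ _ [x [/= <- <-]].
Qed.

End generating_functions.

(* The library's [bigcap_seq] is restricted to a [choiceType]. *)
Lemma bigcap_seq_eqType (I : eqType) (T : Type) (J : seq I) (A : I -> set T) :
  \bigcap_(i in [set` J]) A i = \big[setI/setT]_(i <- J) A i.
Proof.
elim: J => [|i J IH]; first by rewrite big_nil; apply/seteqP; split.
rewrite big_cons -IH; apply/seteqP; split => x /= => [h|[Ai h] j /=].
  by split=> [|j /= jJ]; apply: h => /=; rewrite inE ?eqxx ?jJ ?orbT.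
by rewrite inE => /predU1P[->//|jJ]; exact: h.
Qed.

(** * Independence of generated sigma-algebras *)

Section generated_independence.
Local Open Scope ereal_scope.
Context (R : realType) d (T : measurableType d) (P : probability T R).

(** Dynkin's pi-lambda argument: finite intersections of events of the [F i] with [i] in [D1] form
    the pi-system [G], and the events independent of the fixed intersection over [J] form the
    lambda-system [H]. *)
Lemma independent_generated (I : eqType) (D : set I) (F : I -> set (set T))
    (D1 : set I) (J : seq I) (A : I -> set T) (E : set T) :
  mutually_independent P D F ->
  (forall i, F i `<=` measurable) -> (forall i, setI_closed (F i)) ->
  (forall i, F i setT) ->
  D1 `<=` D -> uniq J -> (forall i, i \in J -> D i /\ ~ D1 i /\ F i (A i)) ->
  <<s \bigcup_(i in D1) F i >> E ->
  P (E `&` \bigcap_(i in [set` J]) A i) = P E * \prod_(i <- J) P (A i).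
Proof.
move=> ind Fm FI FT D1D uJ JA sE.
pose G := [set B | exists J1 A1, [/\ uniq J1, forall i, i \in J1 -> D1 i,
  forall i, F i (A1 i) & B = \bigcap_(i in [set` J1]) A1 i]].
have capm (J1 : seq I) A1 : (forall i, i \in J1 -> F i (A1 i)) ->
    measurable (\bigcap_(i in [set` J1]) A1 i).
  move=> h; rewrite bigcap_seq_eqType big_seq; apply: bigsetI_measurable => i iJ.
  by apply: (Fm i); exact: h.
have mJ : measurable (\bigcap_(i in [set` J]) A i).
  by apply: capm => i /JA[_ []].
have GI : setI_closed G.
  move=> _ _ [J1 [A1 [uJ1 JD1 FA1 ->]]] [J2 [A2 [uJ2 JD2 FA2 ->]]].
  (* The two index lists are merged, and each family is padded with [setT] outside of its own
     list. *)
  exists (undup (J1 ++ J2)), (fun i => (if i \in J1 then A1 i else setT) `&`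
    (if i \in J2 then A2 i else setT)); split.
  - exact: undup_uniq.
  - by move=> i; rewrite mem_undup mem_cat => /orP[/JD1|/JD2].
  - by move=> i; apply: FI; case: ifP.
  - apply/seteqP; split => x /=.
      move=> [h1 h2] i /= _; split; first by case: ifP => // /h1.
      by case: ifP => // /h2.
    move=> h; split => i /= iJ.
      by have /= := h i; rewrite mem_undup mem_cat iJ => /(_ isT)[].
    by have /= := h i; rewrite mem_undup mem_cat iJ orbT => /(_ isT)[].
pose H := [set B | measurable B /\
  P (B `&` \bigcap_(i in [set` J]) A i) = P B * P (\bigcap_(i in [set` J]) A i)].
have PJ : P (\bigcap_(i in [set` J]) A i) = \prod_(i <- J) P (A i).
  by apply: ind => // i /JA[? []].
rewrite -PJ; suff [_] : H E by [].
have : <<s G >> E.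
  suff h : \bigcup_(i in D1) F i `<=` <<s G >>.
    by apply: (smallest_sub _ h) sE; exact: smallest_sigma_algebra.
  move=> B [i D1i FB]; apply: sub_sigma_algebra.
  exists [:: i], (fun j => if j == i then B else setT); split => //.
  - by move=> j; rewrite inE => /eqP ->.
  - by move=> j; case: eqP => [->|].
  - rewrite bigcap_seq_eqType big_seq1 eqxx//.
rewrite -setI_closed_g_dynkin_g_sigma_algebra//; apply: smallest_sub.
  split.
  - by split => //; rewrite setTI probability_setT mul1e.
  - move=> B [mB PB]; split; first exact: measurableC.
    rewrite probability_setC// setIC -setDE measureD//; last first.
      by rewrite ltey_eq fin_num_measure.
    have PB' : P (\bigcap_(i in [set` J]) A i `&` B) =
        P B * P (\bigcap_(i in [set` J]) A i) by rewrite setIC PB.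
    transitivity (P (\bigcap_(i in [set` J]) A i) -
        P B * P (\bigcap_(i in [set` J]) A i)); first by congr (_ - _).
    rewrite muleBl ?mul1e//.
      by rewrite fin_num_measure.
  - move=> B tB HB; have mB n : measurable (B n) by have [] := HB n.
    split; first exact: bigcup_measurable.
    rewrite setI_bigcupl !measure_bigcup//=.
    + rewrite (eq_eseriesr (fun n _ => (HB n).2)) -(fineK (fin_num_measure P _ mJ)).
      under eq_eseriesr do rewrite muleC.
      rewrite nneseriesZl; first by rewrite muleC.
      by move=> n _.
    + by move=> n _; exact: measurableI.
    + exact: trivIset_setIr.
move=> _ [J1 [A1 [uJ1 JD1 FA1 ->]]]; split; first exact: capm.
have dis i : i \in J1 -> i \in J = false.
  by move=> iJ1; apply/negP => /JA[_ [nD _]]; exact: nD (JD1 _ iJ1).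
have -> : \bigcap_(i in [set` J1]) A1 i `&` \bigcap_(i in [set` J]) A i =
    \bigcap_(i in [set` J1 ++ J]) (if i \in J then A i else A1 i).
  apply/seteqP; split => x /=.
    move=> [h1 h2] i /=; rewrite mem_cat; case: ifP => [iJ _|_]; first exact: h2.
    by rewrite orbF; exact: h1.
  move=> h; split => i /= ii; have := h i; rewrite /= mem_cat ii.
    by rewrite dis//; apply.
  by rewrite orbT; apply.
rewrite PJ (ind J1)//.
- rewrite (ind (J1 ++ J)).
  + rewrite big_cat; congr (_ * _); apply: eq_big_seq => i ii.
      by rewrite dis.
    by rewrite ii.
  + rewrite cat_uniq uJ1 uJ andbT /=; apply/hasPn => i iJ.
    by apply: contraL iJ => /dis ->.
  + move=> i; rewrite mem_cat => /orP[ii|ii].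
      by rewrite dis//; split=> //; apply: D1D; exact: JD1.
    by rewrite ii; have [? []] := JA i ii.
- by move=> i ii; split=> //; apply: D1D; exact: JD1.
Qed.

End generated_independence.

(** * Change of root *)

Section tree_parents.
Variables (V : finType) (e : rel V).
Hypothesis te : is_tree e.
Implicit Types r u w : V.

Lemma is_parent_neq r u w : is_parent e r u w -> w != r.
Proof.
move=> /asboolP[p [_ /= /andP[rp _] _]]; apply: contra rp => /eqP ->.
by rewrite mem_rcons mem_head.
Qed.

Lemma is_parent_edge r u w : is_parent e r u w -> e u w.
Proof. by move=> /asboolP[p []]; rewrite rcons_path => /andP[_ +] _ <-. Qed.

Lemma is_parent_uniq r u u' w :
  is_parent e r u w -> is_parent e r u' w -> u = u'.
Proof.
move=> /asboolP[p [pp up <-]] /asboolP[q [pq uq <-]].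
have /rcons_inj[-> //] : rcons p w = rcons q w.
by apply: (tree_path_inj te pp pq up uq); rewrite !last_rcons.
Qed.

Lemma parentP r w : w != r -> is_parent e r (parent e r w) w.
Proof.
move=> wr; rewrite /parent; case: pickP => [//|np].
have [_ _ /(_ r w)/connectP[p0 pp0 wl] _] := te.
case: (shortenP pp0) wl => p pp up _ wl.
case: (lastP p) pp up wl => [|q x] pp up wl; first by rewrite wl eqxx in wr.
rewrite last_rcons in wl; subst x.
by have /negP[] := np (last r q); apply/asboolP; exists q.
Qed.

Lemma is_parentE r u w : is_parent e r u w = (w != r) && (u == parent e r w).
Proof.
apply/idP/andP => [h|[wr /eqP ->]]; last exact: parentP.
split; first exact: is_parent_neq h.
by apply/eqP; apply: is_parent_uniq h (parentP (is_parent_neq h)).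
Qed.

(** The witness is the length of the simple path from the root. Only its growth along [parent] is
    kept: it is the induction measure for statements about ancestors, and its maximum picks a vertex
    that can be peeled. *)
Lemma tree_depth r : exists dep : V -> nat,
  forall w, w != r -> dep w = (dep (parent e r w)).+1.
Proof.
have ex w : exists p, [/\ path e r p, uniq (r :: p) & last r p = w].
  have [_ _ /(_ r w)/connectP[p0 pp0 wl] _] := te.
  by case: (shortenP pp0) wl => p pp up _ wl; exists p.
pose pth w := sval (cid (ex w)); exists (size \o pth) => w wr /=.
have /asboolP[p [pp up lp]] := parentP wr.
have [pp1 up1 lp1] := svalP (cid (ex w)).
have [pp2 up2 lp2] := svalP (cid (ex (parent e r w))).
have -> : pth w = rcons p w.
  by apply: (tree_path_inj te pp1 pp up1 up); rewrite last_rcons.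
have -> : pth (parent e r w) = p.
  apply: (tree_path_inj te pp2 _ up2 _); last by rewrite lp.
    by move: pp; rewrite rcons_path => /andP[].
  by move: up; rewrite -rcons_cons rcons_uniq => /andP[].
by rewrite size_rcons.
Qed.

Lemma edge_neq u w : e u w -> u != w.
Proof.
by have [_ eirr _ _] := te; apply: contraTneq => ->; rewrite eirr.
Qed.

Lemma parent_edge r r' : e r r' -> parent e r r' = r.
Proof.
move=> er; have rr' := edge_neq er.
have : is_parent e r r r'.
  by apply/asboolP; exists [::]; split=> //=; rewrite ?er// inE rr'.
by rewrite is_parentE => /andP[_ /eqP].
Qed.

(** If the path from [r] to [w] avoids [r'], prefixing [r'] gives the path from [r']. Otherwise
    uniqueness of simple paths forces [r'] to be its second vertex, and [r] is dropped. In both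
    cases the last step into [w] is unchanged. *)
Lemma is_parent_reroot_imp r r' u w : e r r' -> w != r -> w != r' ->
  is_parent e r u w -> is_parent e r' u w.
Proof.
move=> er wr wr' /asboolP[p [pp up lp]]; apply/asboolP.
have [esym _ _ _] := te.
have [r'p|r'p] := boolP (r' \in p); last first.
  exists (r :: p); split=> //=.
    by rewrite esym er.
  rewrite inE negb_or mem_rcons inE negb_or eq_sym (edge_neq er) eq_sym wr' r'p.
  by [].
case/splitPr: r'p pp up lp => p1 p2 pp up lp.
have p10 : rcons p1 r' = [:: r'].
  apply: (tree_path_inj te (x := r)).
  - by move: pp; rewrite rcons_cat -cat_rcons cat_path => /andP[].
  - by rewrite /= er.
  - move: up; rewrite rcons_cat -cat_rcons -cat_cons cat_uniq.
    by move=> /andP[].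
  - by rewrite /= inE (edge_neq er).
  - by rewrite last_rcons.
have {p10} p10 : p1 = [::] by case: p1 p10 {pp up lp} => //= a [|b s] [].
subst p1; exists p2; move: pp up lp => /= /andP[_ pp] /and3P[_ -> ->] lp.
by split.
Qed.

Lemma is_parent_reroot r r' u w : e r r' -> w != r -> w != r' ->
  is_parent e r u w = is_parent e r' u w.
Proof.
move=> er wr wr'; have [esym _ _ _] := te.
apply/idP/idP; first exact: is_parent_reroot_imp.
by apply: is_parent_reroot_imp => //; rewrite esym.
Qed.

Lemma parent_reroot r r' w : e r r' -> w != r -> w != r' ->
  parent e r w = parent e r' w.
Proof.
move=> er wr wr'; apply: (is_parent_uniq (r := r)); first exact: parentP.
by rewrite (is_parent_reroot _ er wr wr'); exact: parentP.
Qed.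

(** Here the parent rather than the child lies off the edge, as the products over children in
    [eta_pgf] require. The ends of the edge are harmless as children, since [r] and [r'] only
    exchange their roles of parent and child. *)
Lemma is_parent_off_edge r r' u w : e r r' -> u != r -> u != r' ->
  is_parent e r u w = is_parent e r' u w.
Proof.
move=> er ur ur'; have [esym _ _ _] := te.
have er' : e r' r by rewrite esym.
have [->|wr] := eqVneq w r.
  by rewrite !is_parentE eqxx /= (parent_edge er') (negbTE ur') andbF.
have [->|wr'] := eqVneq w r'.
  by rewrite !is_parentE eqxx /= (parent_edge er) (negbTE ur) andbF.
exact: is_parent_reroot.
Qed.

Section eta.
Variables (R : realType) (t : V -> R).
Implicit Types theta : V -> R.

Lemma eta_pgf_reroot r r' theta theta' w : e r r' -> w != r -> w != r' ->
  (forall j, j != r -> j != r' -> theta j = theta' j) ->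
  eta_pgf e r theta t w = eta_pgf e r' theta' t w.
Proof.
move=> er + + th; rewrite /eta_pgf; elim: #|V| w => [//|n IH] w wr wr' /=.
congr (_ * _); under eq_bigl do rewrite (is_parent_off_edge _ er wr wr').
apply: eq_bigr => j wj; have jr' := is_parent_neq wj.
have jr : j != r.
  by move: wj; rewrite -(is_parent_off_edge _ er wr wr') => /is_parent_neq.
by rewrite th// IH.
Qed.

(** In the tree rooted at [r'], the vertex [r] keeps all its branches except the one through [r'];
    that branch is the last factor. *)
Lemma eta_pgf_edge r r' theta theta' : e r r' ->
  (forall j, j != r -> j != r' -> theta j = theta' j) ->
  eta_pgf e r theta t r =
  eta_pgf e r' theta' t r * (1 - theta r' + theta r' * eta_pgf e r theta t r').
Proof.
move=> er th; have [esym _ _ _] := te.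
have er' : e r' r by rewrite esym.
have rr' := edge_neq er.
rewrite eta_pgfE// [in RHS]eta_pgfE// -mulrA; congr (_ * _).
rewrite (bigD1 r') /=; last first.
  by rewrite is_parentE eq_sym rr' (parent_edge er) eqxx.
rewrite mulrC; congr (_ * _).
rewrite (eq_bigl (is_parent e r' r)) => [|j]; last first.
  have [->|jr'] := eqVneq j r'; first by rewrite andbF is_parentE eqxx.
  rewrite andbT; have [->|jr] := eqVneq j r; last exact: is_parent_reroot.
  by rewrite !is_parentE eqxx (parent_edge er') (negbTE rr') andbF.
apply: eq_bigr => j rj; have jr' := is_parent_neq rj.
have jr : j != r by rewrite eq_sym; exact: (edge_neq (is_parent_edge rj)).
by rewrite th// (eta_pgf_reroot er jr jr' th).
Qed.

(** The root is nobody's child, so the recursion started elsewhere never evaluates [t] at [r]. This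
    makes [eta_pgf] at the root linear in [t r]. *)
Lemma eta_pgf_root_irrelevant r theta (t' : V -> R) w : w != r ->
  (forall u, u != r -> t u = t' u) ->
  eta_pgf e r theta t w = eta_pgf e r theta t' w.
Proof.
move=> + tt'; rewrite /eta_pgf; elim: #|V| w => [|n IH] w wr /=.
  exact: tt'.
rewrite tt'//; congr (_ * _); apply: eq_bigr => j wj.
by rewrite IH//; exact: is_parent_neq wj.
Qed.

Lemma eta_pgf_01 r theta w : (forall u, 0 <= t u <= 1) ->
  (forall u, u != r -> 0 <= theta u <= 1) -> 0 <= eta_pgf e r theta t w <= 1.
Proof.
move=> t01 th01; rewrite /eta_pgf; elim: #|V| w => [//|n IH] w /=.
have h j : is_parent e r w j ->
    0 <= 1 - theta j + theta j * eta_pgf_rec e r theta t n j <= 1.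
  move=> /is_parent_neq /th01 /andP[a b]; have /andP[c d] := IH j.
  rewrite addr_ge0 ?mulr_ge0 ?subr_ge0//=.
  by rewrite -[leRHS](subrK (theta j)) lerD2l ler_piMr.
have /andP[a b] := t01 w.
rewrite mulr_ge0 ?prodr_ge0//=; last by move=> j /h/andP[].
by rewrite mulr_ile1 ?prodr_ge0 ?prodr_ile1// => j /h/andP[].
Qed.

End eta.

End tree_parents.

Section rerooting.
Context (R : realType) (V : finType) (e : rel V).
Variables (lam : V -> R) (alpha : V -> V -> R).
Hypotheses (te : is_tree e) (adm : admissible e lam alpha).

Definition mpmrf_exponent (r : V) (t : V -> R) : R :=
  \sum_w innovation_rate e lam alpha r w *
         (eta_pgf e r (thinning_prob e lam alpha r) t w - 1).

(** The bound on [alpha] is the inverse of the square root that multiplies it. Along an edge this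
    controls the thinning probability; along the reversed edge it makes the innovation rate
    nonnegative. *)
Lemma admissible_thinning u w : e u w ->
  0 <= alpha u w * Num.sqrt (lam w / lam u) <= 1.
Proof.
move=> euw; have [lam0 _ /(_ u w euw)/andP[a0]] := adm.
rewrite le_min => /andP[au _]; rewrite mulr_ge0 ?sqrtr_ge0 ?(ltW a0)//=.
apply: (@le_trans _ _ (Num.sqrt (lam u / lam w) * Num.sqrt (lam w / lam u))).
  by rewrite ler_wpM2r// sqrtr_ge0.
rewrite -sqrtrM ?divr_ge0 ?(ltW (lam0 _))//.
by rewrite mulrA divfK ?gt_eqF// divff ?gt_eqF// sqrtr1.
Qed.

Lemma thinning_prob_01 r w : w != r -> 0 <= thinning_prob e lam alpha r w <= 1.
Proof. by move=> /(parentP te)/is_parent_edge; exact: admissible_thinning. Qed.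

Lemma innovation_rate_ge0 r w : 0 <= innovation_rate e lam alpha r w.
Proof.
have [lam0 asym _] := adm; have [esym _ _ _] := te.
rewrite /innovation_rate; case: eqVneq => [_|wr]; first exact: ltW.
have ew := is_parent_edge (parentP te wr).
rewrite mulr_ge0 ?(ltW (lam0 _))// subr_ge0 asym//.
by have /andP[] : 0 <= alpha w (parent e r w) *
  Num.sqrt (lam (parent e r w) / lam w) <= 1 by apply: admissible_thinning; rewrite esym.
Qed.

(** Only the terms of [r] and [r'] change. With [A] and [C] the functions of the two halves of the
    tree cut along the edge, and [c = alpha r r' * sqrt (lam r * lam r')], they add up to [(lam r -
    c)(A - 1) + (lam r' - c)(C - 1) + c(AC - 1)], which is symmetric in the two ends. *)
Lemma mpmrf_exponent_edge r r' t : e r r' ->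
  mpmrf_exponent r t = mpmrf_exponent r' t.
Proof.
move=> er; have [esym _ _ _] := te; have [lam0 asym _] := adm.
have er' : e r' r by rewrite esym.
have rr' := edge_neq te er.
have r'r : r' != r by rewrite eq_sym.
set th := thinning_prob e lam alpha r; set th' := thinning_prob e lam alpha r'.
have thE j : j != r -> j != r' -> th j = th' j.
  by move=> jr jr'; rewrite /th /th' /thinning_prob (parent_reroot te er jr jr').
have thE' j : j != r' -> j != r -> th' j = th j by move=> ? ?; rewrite thE.
rewrite /mpmrf_exponent -/th -/th' (bigD1 r)//= (bigD1 r')//= [RHS](bigD1 r)//=.
rewrite [in RHS](bigD1 r')//= !addrA; congr (_ + _); last first.
  apply: eq_bigr => w /andP[wr wr'].
  rewrite /innovation_rate (negbTE wr) (negbTE wr') (parent_reroot te er wr wr').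
  by rewrite (eta_pgf_reroot te t er wr wr' thE).
rewrite (eta_pgf_edge te t er thE) (eta_pgf_edge te t er' thE').
rewrite /innovation_rate !eqxx (negbTE rr') (negbTE r'r).
rewrite /th /th' /thinning_prob (parent_edge te er) (parent_edge te er').
rewrite (asym _ _ er') -/th -/th'.
set A := eta_pgf _ r' _ _ r; set C := eta_pgf _ r _ _ r'.
have [l0 l0'] := (lam0 r, lam0 r').
(* Writing [lam r] and [lam r'] as squares turns the square roots of their quotients into [x / y]
   and [y / x], and the claim into an identity of rational functions. *)
have sqE (c : R) : 0 < c -> exists2 x, 0 < x & c = x ^+ 2.
  by move=> c0; exists (Num.sqrt c); rewrite ?sqrtr_gt0// sqr_sqrtr// ltW.
have [[x x0 ->] [y y0 ->]] := (sqE _ l0, sqE _ l0').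
rewrite -!expr_div_n !sqrtr_sqr !ger0_norm ?divr_ge0 ?(ltW x0) ?(ltW y0)//.
by field; rewrite !gt_eqF.
Qed.

Lemma mpmrf_exponent_root r r' t : mpmrf_exponent r t = mpmrf_exponent r' t.
Proof.
have [_ _ /(_ r r')/connectP[p pp ->] _] := te.
elim: p r pp => //= a p IH r /andP[er pp].
by rewrite (mpmrf_exponent_edge t er) IH.
Qed.

End rerooting.

(** * The generating function of the random field *)

Section poisson_bernoulli_pgf.
Local Open Scope ereal_scope.
Context (R : realType).

Lemma nneseries_expR (x : R) :
  \sum_(k <oo) (x ^+ k / k`!%:R)%:E = (expR x)%:E.
Proof.
rewrite expRE -EFin_lim; last first.
  rewrite /pseries/=; under eq_fun do rewrite mulrC.
  exact: is_cvg_series_exp_coeff.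
apply/congr_lim/funext => n/=; rewrite /pseries/= /series/= -sumEFin//.
by under eq_bigr do rewrite mulrC.
Qed.

Lemma poisson_prob_set1 (rate : R) (n k : nat) : (0 <= rate)%R ->
  poisson_prob rate n [set k] = (rate ^+ k / k`!%:R * expR (- rate))%:E.
Proof.
rewrite le_eqVlt /poisson_prob => /predU1P[<-|rate0].
  rewrite ltxx diracE oppr0 expR0 mulr1 expr0n classical_sets.in_set1 eq_sym.
  by case: k => [|k]; rewrite ?fact0 ?divr1//= mul0r.
by rewrite rate0 esum_set1 ?lee_fin ?poisson_pmf_ge0// /poisson_pmf rate0.
Qed.

Context d (T : measurableType d) (P : probability T R).

Lemma poisson_pgf (X : {RV P >-> nat}) (rate s : R) : (0 <= rate)%R -> (0 <= s)%R ->
  distribution P X =1 poisson_prob rate 0 ->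
  \int[P]_x (s ^+ X x)%:E = (expR (rate * (s - 1)))%:E.
Proof.
move=> rate0 s0 XE.
transitivity (\int[P]_x (1 * s ^+ X x)%:E).
  by under [RHS]eq_integral do rewrite mul1r.
rewrite (integral_level_sets P (W := fun=> 1%R) (phi := fun k => s ^+ k)%R)//; last first.
  by move=> k; rewrite exprn_ge0.
transitivity ((expR (- rate))%:E * \sum_(k <oo) ((rate * s) ^+ k / k`!%:R)%:E); last first.
  by rewrite nneseries_expR -EFinM -expRD; congr (expR _)%:E; ring.
rewrite -nneseriesZl => [|k _]; last first.
  by rewrite lee_fin divr_ge0// exprn_ge0// mulr_ge0.
apply: eq_eseriesr => k _.
have -> : \int[P]_(x in [set x | X x = k]) 1%:E = (rate ^+ k / k`!%:R * expR (- rate))%:E.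
  rewrite integral_cst; last by apply: (@measurable_preimage _ _ _ _ X [set k]).
  by rewrite mul1e -(poisson_prob_set1 0)// -XE.
by rewrite -!EFinM exprMn; congr EFin; ring.
Qed.

Lemma bernoulli_pgf (X : {RV P >-> bool}) (p s : R) : (0 <= p <= 1)%R -> (0 <= s)%R ->
  distribution P X =1 bernoulli_prob p ->
  \int[P]_x (s ^+ nat_of_bool (X x))%:E = (1 - p + p * s)%:E.
Proof.
move=> p01 s0 XE.
rewrite -(ge0_integral_distribution X (f := fun b : bool => (s ^+ b)%:E))//; last first.
  by move=> b; rewrite lee_fin exprn_ge0.
rewrite (eq_measure_integral (bernoulli_prob p)) => [|A _ _]; last exact: XE.
rewrite integral_bernoulli_prob//; last by move=> b; rewrite lee_fin exprn_ge0.
by rewrite expr1 expr0 -!EFinM -EFinD; congr EFin; rewrite /unstable.onem; ring.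
Qed.

End poisson_bernoulli_pgf.

Section sigma_var_structure.
Context d d' (T : measurableType d) (E : measurableType d').

Lemma sigma_varE (X : T -> E) (A : set E) : measurable A ->
  sigma_var X (X @^-1` A).
Proof. by move=> mA; exists A => //; rewrite setTI. Qed.

Lemma sigma_var_setT (X : T -> E) : sigma_var X setT.
Proof. by rewrite -(preimage_setT X); exact: sigma_varE. Qed.

Lemma sigma_var_measurable (X : T -> E) :
  measurable_fun setT X -> sigma_var X `<=` measurable.
Proof. by move=> mX _ [A mA <-]; exact: mX. Qed.

Lemma sigma_var_setI (X : T -> E) : setI_closed (sigma_var X).
Proof.
move=> _ _ [A mA <-] [B mB <-]; exists (A `&` B); first exact: measurableI.
by rewrite !setTI preimage_setI.
Qed.

End sigma_var_structure.

Section mpmrf_pgf.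
Local Open Scope ereal_scope.
Context (R : realType) (V : finType) (e : rel V).
Variables (lam : V -> R) (alpha : V -> V -> R).
Hypotheses (te : is_tree e) (adm : admissible e lam alpha).
Context d (T : measurableType d) (P : probability T R).
Variables (r : V) (L : V -> {RV P >-> nat}) (B : V -> nat -> {RV P >-> bool}).
Variables (M : V -> {RV P >-> nat}).
Hypothesis ME : mpmrf_construction e lam alpha r L B M.

Let theta := thinning_prob e lam alpha r.
Let rate := innovation_rate e lam alpha r.

Let items (i : V + V * nat) : set (set T) :=
  match i with inl w => sigma_var (L w) | inr (w, j) => sigma_var (B w j) end.

Let vertex (i : V + V * nat) : V := match i with inl w => w | inr (w, _) => w end.

Let used : set (V + V * nat) :=
  [set i | if i is inr (w, _) then w != r else true].

(** Booleans are read as 0 or 1 so that innovations and thinning variables form a single family of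
    [nat]-valued variables. *)
Let item_val (i : V + V * nat) (x : T) : nat :=
  match i with inl w => L w x | inr (w, j) => nat_of_bool (B w j x) end.

Let item_val_measurable i : measurable_fun setT (item_val i).
Proof.
case: i => [w|[w j]] /=; first exact: measurable_funPT.
by apply: (measurableT_comp (f := nat_of_bool)) => //; exact: measurable_funPT.
Qed.

Let items_preimage i (D : set nat) : items i (item_val i @^-1` D).
Proof.
case: i => [w|[w j]] /=; first exact: sigma_varE.
by rewrite (_ : _ @^-1` D = B w j @^-1` (nat_of_bool @^-1` D))//; exact: sigma_varE.
Qed.

(** The recursion is unrolled by induction on the depth; the ancestors met are all in [A], which is
    closed under parents. It is used to show that the field on [A] is independent of the noise
    attached to a vertex outside of [A]. *)
Lemma ancestor_measurable (A : {set V}) (F : set (set T)) u :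
  (forall u, u \in A -> u != r -> parent e r u \in A) ->
  (forall u, u \in A -> sigma_var (L u) `<=` F) ->
  (forall u j, u \in A -> u != r -> sigma_var (B u j) `<=` F) ->
  u \in A ->
  @measurable_fun _ _ (g_sigma_algebraType F) nat setT (M u).
Proof.
move=> clA LF BF; have [dep depE] := tree_depth te r.
have mL w : w \in A -> @measurable_fun _ _ (g_sigma_algebraType F) nat setT (L w).
  move=> wA _ D mD; apply: sub_sigma_algebra; apply: (LF w wA).
  by rewrite setTI; exact: sigma_varE.
have mB w j : w \in A -> w != r ->
    @measurable_fun _ _ (g_sigma_algebraType F) bool setT (B w j).
  move=> wA wr _ D mD; apply: sub_sigma_algebra; apply: (BF w j wA wr).
  by rewrite setTI; exact: sigma_varE.
have [n] := ubnP (dep u); elim: n u => // n IH u; rewrite ltnS => un uA.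
have [ur|ur] := eqVneq u r.
  rewrite (_ : (M u : T -> nat) = L u); first exact: mL.
  by apply/funext => x; rewrite ur; exact: (mpmrf_root ME).
rewrite (_ : (M u : T -> nat) = fun x =>
    (thinning (fun j => B u j x) (M (parent e r u) x) + L u x)%N); last first.
  by apply/funext => x; exact: (mpmrf_step ME).
apply: measurable_fun_addn; last exact: mL.
apply: (@measurable_fun_random_sum _ (g_sigma_algebraType F) (M (parent e r u))
  (fun j x => nat_of_bool (B u j x))).
  by apply: IH; [move: un; rewrite (depE _ ur)|exact: clA].
move=> j; apply: (measurableT_comp (f := nat_of_bool)) => //.
exact: mB.
Qed.

(** Given the field on [A], [M w] is a Poisson variable plus as many Bernoulli variables as the
    count of the parent, all independent. The Bernoulli part gives a power whose exponent is that
    count; as the parent lies in [A], what remains is again an integral over the field on [A]. *)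
Lemma mpmrf_peel (A : {set V}) (w : V) (s : V -> R) :
  (forall u, u \in A -> u != r -> parent e r u \in A) ->
  w \notin A -> w != r -> parent e r w \in A -> (forall u, (0 <= s u)%R) ->
  \int[P]_x ((\prod_(u in A) s u ^+ M u x) * s w ^+ M w x)%:E =
  (expR (rate w * (s w - 1)))%:E *
  \int[P]_x ((\prod_(u in A) s u ^+ M u x) *
             (1 - theta w + theta w * s w) ^+ M (parent e r w) x)%:E.
Proof.
move=> clA wA wr pA s0.
have th01 : (0 <= theta w <= 1)%R by exact: thinning_prob_01.
have b0 : (0 <= 1 - theta w + theta w * s w)%R.
  by move: th01 => /andP[a b]; rewrite addr_ge0 ?subr_ge0//; exact: mulr_ge0 a (s0 w).
(* Entries outside of [A] are set to 0, so that the fibres of [Y] involve no noise of [w]. *)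
pose Y x : {ffun V -> nat} := [ffun u => if u \in A then M u x else 0%N].
pose F : set (set T) := \bigcup_(i in [set i | used i /\ vertex i != w]) items i.
have mM u : measurable_fun setT (M u) by exact: measurable_funPT.
have mprod : measurable_fun setT (fun x => \prod_(u in A) s u ^+ M u x)%R.
  apply: measurable_prod_cond => u.
  by apply: (measurable_comp_nat (fun n => s u ^+ n)%R).
have prod0 x : (0 <= \prod_(u in A) s u ^+ M u x)%R.
  by apply: prodr_ge0 => u _; rewrite exprn_ge0.
have FY y : <<s F >> (Y @^-1` [set y]).
  apply: (@measurable_fiber _ (g_sigma_algebraType F) V
    (fun u x => if u \in A then M u x else 0%N) y) => u.
  move=> /=; case: (boolP (u \in A)) => uA; last exact: measurable_cst.
  apply: (@ancestor_measurable A) => //.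
    move=> z zA D LD; exists (inl z) => //; split => //=.
    by apply: contraNneq wA => <-.
  move=> z j zA zr D LD; exists (inr (z, j)) => //; split => //=.
  by apply: contraNneq wA => <-.
have mY y : measurable (Y @^-1` [set y]).
  apply: (@measurable_fiber _ _ V (fun u x => if u \in A then M u x else 0%N)) => u.
  by move=> /=; case: (u \in A); [exact: mM|exact: measurable_cst].
apply: (integral_fibers_proportional (Y1 := Y) (Y2 := Y)) => //.
- apply/measurable_EFinP; apply: measurable_funM => //.
  exact: (measurable_comp_nat (fun n => s w ^+ n)%R).
- by move=> x _; rewrite lee_fin mulr_ge0// exprn_ge0.
- apply/measurable_EFinP; apply: measurable_funM => //.
  exact: (measurable_comp_nat (fun n => (1 - theta w + theta w * s w) ^+ n)%R).
- by move=> x _; rewrite lee_fin mulr_ge0// exprn_ge0.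
move=> y; rewrite !setTI.
pose m := y (parent e r w).
(* On the fibre, [M w] is the sum of exactly these items: the innovation of [w] and its first [m]
   thinning variables. *)
pose J : seq (V + V * nat) := inl w :: [seq inr (w, j) | j <- iota 0 m].
have YM x u : Y x = y -> u \in A -> M u x = y u.
  by move=> <- uA; rewrite ffunE uA.
pose q := (\prod_(u in A) s u ^+ y u)%R.
have q0 : (0 <= q)%R by apply: prodr_ge0 => u _; rewrite exprn_ge0.
have prodq x : Y x = y -> (\prod_(u in A) s u ^+ M u x)%R = q.
  by move=> Yx; apply: eq_bigr => u uA; rewrite YM.
transitivity (q%:E * \int[P]_(x in Y @^-1` [set y])
    (\prod_(i <- J) s w ^+ item_val i x)%:E).
  rewrite -ge0_integralZl//; last 2 first.
  - apply: measurable_funTS; apply/measurable_EFinP; apply: measurable_prod => i _.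
    exact: (measurable_comp_nat (fun n => s w ^+ n)%R).
  - by move=> x _; rewrite lee_fin prodr_ge0// => i _; rewrite exprn_ge0.
  apply: eq_integral => x; rewrite inE => /= Yx; rewrite -EFinM prodq//.
  congr (q * _)%:E; rewrite (mpmrf_step ME _ wr) YM// /thinning /random_sum.
  rewrite exprD mulrC big_cons /=; congr (_ * _)%R.
  rewrite big_map expr_sum -(big_mkord xpredT (fun j => s w ^+ B w j x))%R.
  by rewrite /index_iota subn0.
transitivity (q%:E * ((1 - theta w + theta w * s w) ^+ m)%:E *
    (expR (rate w * (s w - 1)))%:E * P (Y @^-1` [set y])); last first.
  rewrite -[LHS]muleA muleCA; congr (_ * _).
  rewrite -EFinM -integral_cst//; apply: eq_integral => x; rewrite inE => /= Yx.
  by rewrite prodq// YM.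
have intL : \int[P]_x (s w ^+ L w x)%:E = (expR (rate w * (s w - 1)))%:E.
  apply: poisson_pgf => //; last exact: (mpmrf_poisson ME).
  exact: innovation_rate_ge0.
have intB j : \int[P]_x (s w ^+ nat_of_bool (B w j x))%:E =
    (1 - theta w + theta w * s w)%:E.
  by apply: bernoulli_pgf => //; exact: (mpmrf_bernoulli ME).
rewrite (integral_prod_independent (P := P) (J := J) (Y := item_val)
  (f := fun _ n => s w ^+ n)%R)//.
- rewrite big_cons /= intL big_map.
  rewrite (eq_bigr (fun=> (1 - theta w + theta w * s w)%:E)) => [|j _];
    last exact: intB.
  have -> : \prod_(j <- iota 0 m) (1 - theta w + theta w * s w)%:E =
      ((1 - theta w + theta w * s w) ^+ m)%:E.
    by rewrite prodEFin big_const_seq count_predT size_iota iter_mulr_1.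
  rewrite -!muleA; congr (_ * _); rewrite muleC -!muleA muleCA.
  by [].
- rewrite /= map_inj_uniq ?iota_uniq ?andbT//; last by move=> a b [].
  by apply/mapP => -[].
- by move=> i n; rewrite exprn_ge0.
- by move=> i; rewrite inE => /predU1P[->|/mapP[j _ ->]] /=; rewrite ?intL ?intB ltry.
move=> D; apply: (independent_generated (F := items) (D := used)
  (D1 := [set i | used i /\ vertex i != w])).
- exact: (mpmrf_independent ME).
- by move=> [u|[u j]]; apply: sigma_var_measurable; exact: measurable_funPT.
- by move=> [u|[u j]]; exact: sigma_var_setI.
- by move=> [u|[u j]]; exact: sigma_var_setT.
- by move=> i [].
- rewrite /= map_inj_uniq ?iota_uniq ?andbT//; last by move=> a b [].
  by apply/mapP => -[].
- move=> i; rewrite inE => /predU1P[->|/mapP[j _ ->]]; split => //; split.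
  + by move=> [_ /=]; rewrite eqxx.
  + exact: items_preimage.
  + by move=> [_ /=]; rewrite eqxx.
  + exact: items_preimage.
- exact: FY.
Qed.

End mpmrf_pgf.

Section mpmrf_joint_pgf.
Local Open Scope ereal_scope.
Context (R : realType) (V : finType) (e : rel V).
Variables (lam : V -> R) (alpha : V -> V -> R).
Hypotheses (te : is_tree e) (adm : admissible e lam alpha).

Section construction.
Context d (T : measurableType d) (P : probability T R).
Variables (r : V) (L : V -> {RV P >-> nat}) (B : V -> nat -> {RV P >-> bool}).
Variables (M : V -> {RV P >-> nat}).
Hypothesis ME : mpmrf_construction e lam alpha r L B M.
Variable t : V -> R.
Hypothesis t01 : forall w, (0 <= t w <= 1)%R.

Let theta := thinning_prob e lam alpha r.
Let rate := innovation_rate e lam alpha r.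
Let eta := eta_pgf e r theta t.

Let theta01 w : w != r -> (0 <= theta w <= 1)%R.
Proof. exact: thinning_prob_01. Qed.

Let eta01 w : (0 <= eta w <= 1)%R.
Proof. exact: eta_pgf_01. Qed.

(* The argument of the generating function of [(M u)_(u in A)] that accounts
   for the thinning of [M u] into its children outside of [A]. *)
Let pruned (A : {set V}) (u : V) : R :=
  (t u * \prod_(j | is_parent e r u j && (j \notin A))
           (1 - theta j + theta j * eta j))%R.

Let factor_ge0 j : j != r -> (0 <= 1 - theta j + theta j * eta j)%R.
Proof.
move=> /theta01/andP[a b]; have /andP[c _] := eta01 j.
by rewrite addr_ge0 ?subr_ge0//; exact: mulr_ge0.
Qed.

Let pruned_ge0 (A : {set V}) u : (0 <= pruned A u)%R.
Proof.
have /andP[a _] := t01 u; apply: mulr_ge0 => //; apply: prodr_ge0 => j.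
by move=> /andP[/is_parent_neq jr _]; exact: factor_ge0.
Qed.

Let pruned_all (A : {set V}) u : (forall j, is_parent e r u j -> j \notin A) ->
  pruned A u = eta u.
Proof.
move=> h; rewrite /eta eta_pgfE// /pruned; congr (_ * _)%R.
by apply: eq_bigl => j; case: (boolP (is_parent e r u j)) => //= /h ->.
Qed.

(** A deepest [w] in [A] has no child in [A], so its argument is already [eta w]. Peeling it yields
    its exponential factor and multiplies the argument of its parent by
    [1 - theta w + theta w * eta w], which is the passage from [pruned A] to [pruned (A :\ w)]. *)
Lemma mpmrf_pgf_closed (A : {set V}) : r \in A ->
  (forall u, u \in A -> u != r -> parent e r u \in A) ->
  \int[P]_x (\prod_(u in A) pruned A u ^+ M u x)%:E =
  (expR (\sum_(w in A) rate w * (eta w - 1)))%:E.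
Proof.
have [dep depE] := tree_depth te r.
have [n] := ubnP #|A|; elim: n A => // n IH A; rewrite ltnS => An rA clA.
have [Ar|/finset.set0Pn[w0 w0A]] := eqVneq (A :\ r) finset.set0.
  have AE : A = [set r]%SET by rewrite -(finset.setD1K rA) Ar finset.setU0.
  rewrite AE big_set1; under eq_integral do rewrite big_set1.
  rewrite pruned_all => [|j /is_parent_neq jr]; last by rewrite inE.
  have <- : \int[P]_x (eta r ^+ L r x)%:E = (expR (rate r * (eta r - 1)))%:E.
    apply: poisson_pgf; last exact: (mpmrf_poisson ME).
      exact: innovation_rate_ge0.
    by have /andP[] := eta01 r.
  by apply: eq_integral => x _; rewrite (mpmrf_root ME).
have [w wA wmax] : exists2 w, w \in A :\ r & forall u,
    u \in A :\ r -> (dep u <= dep w)%N.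
  by case: (arg_maxnP dep w0A) => w wA wmax; exists w.
move: wA; rewrite !inE => /andP[wr wA].
have pw : is_parent e r (parent e r w) w by exact: parentP.
have pwA : parent e r w \in A :\ w.
  rewrite !inE clA// andbT; apply/eqP => E.
  by have := depE _ wr; rewrite E => /eqP; rewrite ltn_eqF.
have clA' u : u \in A :\ w -> u != r -> parent e r u \in A :\ w.
  rewrite !inE => /andP[uw uA] ur; rewrite clA// andbT; apply/eqP => E.
  have : (dep u <= dep w)%N by apply: wmax; rewrite !inE ur.
  by rewrite (depE _ ur) E ltnn.
have rA' : r \in A :\ w by rewrite !inE eq_sym wr.
have wE : pruned A w = eta w.
  apply: pruned_all => j wj; apply/negP => jA.
  have jr := is_parent_neq wj.
  have : (dep j <= dep w)%N by apply: wmax; rewrite !inE jr.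
  by move: wj; rewrite (is_parentE te) => /andP[_ /eqP ->]; rewrite (depE _ jr) ltnn.
rewrite (bigD1 w)//= expRD EFinM.
have -> : (\sum_(i in A | i != w) rate i * (eta i - 1) =
    \sum_(i in A :\ w) rate i * (eta i - 1))%R.
  by apply: eq_bigl => u; rewrite !inE andbC.
rewrite -IH//; last by apply: leq_trans An; rewrite [X in (_ < X)%N](cardsD1 w) wA.
rewrite -wE; transitivity (\int[P]_x
    ((\prod_(u in A :\ w) pruned A u ^+ M u x) * pruned A w ^+ M w x)%:E).
  apply: eq_integral => x _; congr EFin; rewrite mulrC (bigD1 w)//=.
  by congr (_ * _)%R; apply: eq_bigl => u; rewrite !inE andbC.
rewrite (mpmrf_peel te adm ME clA')//; last by rewrite !inE eqxx.
congr (_ * _); apply: eq_integral => x _; congr EFin.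
rewrite (bigD1 (parent e r w))//= [RHS](bigD1 (parent e r w))//= mulrAC.
congr (_ * _)%R; last first.
  apply: eq_bigr => u /andP[uA up]; congr (_ ^+ _)%R; rewrite /pruned.
  congr (_ * _)%R; apply: eq_bigl => j; rewrite !inE negb_and negbK.
  case: (eqVneq j w) => [->|//] /=.
  by rewrite is_parentE// (negbTE up) !andbF.
rewrite -exprMn; congr (_ ^+ _)%R; rewrite /pruned -mulrA; congr (_ * _)%R.
rewrite [RHS](bigD1 w)/=; last by rewrite pw !inE eqxx.
rewrite mulrC -wE; congr (_ * _)%R; apply: eq_bigl => j.
rewrite !inE negb_and negbK; case: (eqVneq j w) => [->|jw] /=; last by rewrite andbT.
by rewrite wA !andbF.
Qed.

Lemma mpmrf_construction_pgf :
  \int[P]_x (\prod_u t u ^+ M u x)%:E = (expR (mpmrf_exponent e lam alpha r t))%:E.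
Proof.
transitivity (\int[P]_x (\prod_(u in [set: V]%SET) pruned [set: V]%SET u ^+ M u x)%:E).
  apply: eq_integral => x _; congr EFin; apply: eq_big => [u|u _].
    by rewrite inE.
  rewrite /pruned big_pred0 ?mulr1// => j.
  by rewrite inE andbF.
rewrite mpmrf_pgf_closed ?inE//.
by congr (expR _)%:E; apply: eq_bigl => w; rewrite inE.
Qed.

End construction.

(** The construction lives on another space and has an unknown root. The two laws are compared on
    the fibres of the counts, where both integrands are constant, and the invariance of the exponent
    allows any root [v]. *)
Lemma mpmrf_pgf d (T : measurableType d) (P : probability T R)
    (N : V -> {RV P >-> nat}) (t : V -> R) (v : V) :
  is_mpmrf e lam alpha N -> (forall w, (0 <= t w <= 1)%R) ->
  \int[P]_x (\prod_u t u ^+ N u x)%:E =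
  (expR (mpmrf_exponent e lam alpha v t))%:E.
Proof.
move=> [r [d' [T' [P' [L [I [M [ME NM]]]]]]]] t01.
rewrite -(mpmrf_exponent_root te adm r v) -(mpmrf_construction_pgf ME t01).
rewrite -[RHS]mul1e.
pose Y x : {ffun V -> nat} := [ffun u => N u x].
pose Y' x : {ffun V -> nat} := [ffun u => M u x].
have ge0 (g : V -> nat) : (0 <= \prod_u t u ^+ g u)%R.
  by apply: prodr_ge0 => u _; have /andP[? _] := t01 u; rewrite exprn_ge0.
have mp d0 (T0 : measurableType d0) (Z : V -> T0 -> nat) :
    (forall u, measurable_fun setT (Z u)) ->
    measurable_fun setT (fun x => (\prod_u t u ^+ Z u x)%:E).
  move=> mZ; apply/measurable_EFinP; apply: measurable_prod_cond => u.
  exact: (measurable_comp_nat (fun n => t u ^+ n)%R).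
have mYN y : measurable (Y @^-1` [set y]).
  by apply: (@measurable_fiber _ _ V (fun u => N u)) => u; exact: measurable_funPT.
have mYM y : measurable (Y' @^-1` [set y]).
  by apply: (@measurable_fiber _ _ V (fun u => M u)) => u; exact: measurable_funPT.
apply: (integral_fibers_proportional (Y1 := Y) (Y2 := Y') (c := 1%R)) => //.
- by apply: mp => u; exact: measurable_funPT.
- by move=> x _; rewrite lee_fin.
- by apply: mp => u; exact: measurable_funPT.
- by move=> x _; rewrite lee_fin.
move=> y; rewrite !setTI mul1e.
transitivity ((\prod_u t u ^+ y u)%:E * P (Y @^-1` [set y])).
  rewrite -integral_cst//; apply: eq_integral => x; rewrite inE => /= <-.
  by congr EFin; apply: eq_bigr => u _; rewrite ffunE.
transitivity ((\prod_u t u ^+ y u)%:E * P' (Y' @^-1` [set y])); last first.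
  rewrite -integral_cst//; apply: eq_integral => x; rewrite inE => /= <-.
  by congr EFin; apply: eq_bigr => u _; rewrite ffunE.
congr (_ * _).
have E (S : Type) (Z : V -> S -> nat) :
    [set x | [ffun u => Z u x] = y] =
    [set x | [set g : V -> nat | g = fun u => y u] (Z^~ x)].
  apply/seteqP; split => x /=.
    by move=> <-; apply/funext => u; rewrite ffunE.
  by move=> h; apply/ffunP => u; rewrite ffunE; exact: (congr1 (@^~ u) h).
have := NM [set g : V -> nat | g = fun u => y u].
by rewrite -!E.
Qed.

End mpmrf_joint_pgf.

(** * Compound sums *)

Section compound_sums.
Local Open Scope ereal_scope.
Context (R : realType) (V : finType) d (T : measurableType d).
Variables (P : probability T R) (N : V -> T -> nat) (C : V -> nat -> T -> nat).
Hypothesis mN : forall w, measurable_fun setT (N w).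
Hypothesis mC : forall w i, measurable_fun setT (C w i).

Let count x : {ffun V -> nat} := [ffun w => N w x].

Hypothesis NC_indep : forall (y : {ffun V -> nat}) (J : seq (V * nat))
    (D : V * nat -> set nat), uniq J ->
  P (count @^-1` [set y] `&` \bigcap_(p in [set` J]) C p.1 p.2 @^-1` D p) =
  P (count @^-1` [set y]) * \prod_(p <- J) P (C p.1 p.2 @^-1` D p).

Let mcount y : measurable (count @^-1` [set y]).
Proof. exact: (@measurable_fiber _ _ V N). Qed.

(** On a fibre of the counts the random sums have fixed lengths, so the product runs over a fixed
    list of index pairs. Letting [f] depend on the pair allows one distinguished claim to carry
    another weight. *)
Lemma integral_count_fiber (y : {ffun V -> nat}) (f : V * nat -> nat -> R)
    (b : V * nat -> R) :
  (forall p n, (0 <= f p n)%R) ->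
  (forall p, \int[P]_x (f p (C p.1 p.2 x))%:E = (b p)%:E) ->
  \int[P]_(x in count @^-1` [set y])
     (\prod_w \prod_(i < y w) f (w, nat_of_ord i) (C w i x))%:E =
  P (count @^-1` [set y]) * (\prod_w \prod_(i < y w) b (w, nat_of_ord i))%:E.
Proof.
move=> f0 fb.
pose J : seq (V * nat) := [seq (w, i) | w <- index_enum V, i <- iota 0 (y w)].
have JE (F : V * nat -> R) :
    (\prod_w \prod_(i < y w) F (w, nat_of_ord i) = \prod_(p <- J) F p)%R.
  rewrite /J big_allpairs_dep; apply: eq_bigr => w _.
  by rewrite -(big_mkord xpredT (fun i => F (w, i))) /index_iota subn0.
have uJ : uniq J.
  apply: allpairs_uniq_dep => [|w _|[w i] [w' i'] _ _ /= [-> ->]//].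
    exact: index_enum_uniq.
  exact: iota_uniq.
under eq_integral do rewrite (JE (fun p => f p (C p.1 p.2 _))).
rewrite (integral_prod_independent (P := P) (J := J)
  (Y := fun p => C p.1 p.2) (f := f))//.
- rewrite (eq_bigr (fun p => (b p)%:E)) => [|p _]; last exact: fb.
  by rewrite prodEFin JE.
- by move=> p _; rewrite fb ltry.
- by move=> D; exact: NC_indep.
Qed.

Let mprodN (b : V -> R) (Q : pred V) :
  measurable_fun setT (fun x => \prod_(w | Q w) b w ^+ N w x)%R.
Proof.
apply: measurable_prod_cond => w.
exact: (measurable_comp_nat (fun n => b w ^+ n)%R).
Qed.

Lemma measurable_compound w : measurable_fun setT (compound N C w).
Proof. exact: measurable_fun_random_sum. Qed.

Lemma measurable_aggregate : measurable_fun setT (aggregate N C).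
Proof. by apply: measurable_fun_sumn => w; exact: measurable_compound. Qed.

Lemma expr_aggregate (s : R) x :
  (s ^+ aggregate N C x = \prod_w \prod_(i < N w x) s ^+ C w i x)%R.
Proof. by rewrite expr_sum; apply: eq_bigr => w _; rewrite expr_sum. Qed.

(** This serves twice: for [S], and for the allocation, which is also an aggregate. *)
Lemma aggregate_pgf (s : R) (b : V -> R) : (0 <= s)%R ->
  (forall w, (0 <= b w)%R) ->
  (forall w i, \int[P]_x (s ^+ C w i x)%:E = (b w)%:E) ->
  \int[P]_x (s ^+ aggregate N C x)%:E = \int[P]_x (\prod_w b w ^+ N w x)%:E.
Proof.
move=> s0 b0 sb; rewrite -[RHS]mul1e.
apply: (integral_fibers_proportional (Y1 := count) (Y2 := count) (c := 1%R)) => //.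
- apply/measurable_EFinP.
  by apply: (measurable_comp_nat (fun n => s ^+ n)%R); exact: measurable_aggregate.
- by move=> x _; rewrite lee_fin exprn_ge0.
- by apply/measurable_EFinP; exact: mprodN.
- by move=> x _; rewrite lee_fin prodr_ge0// => w _; rewrite exprn_ge0.
move=> y; rewrite mul1e !setTI.
transitivity (\int[P]_(x in count @^-1` [set y])
     (\prod_w \prod_(i < y w) s ^+ C w i x)%:E).
  apply: eq_integral => x; rewrite inE => /= <-; rewrite expr_aggregate.
  by congr EFin; apply: eq_bigr => w _; rewrite ffunE.
rewrite (integral_count_fiber y (f := fun _ n => (s ^+ n)%R) (b := fun p => b p.1))//.
- rewrite muleC -integral_cst//; apply: eq_integral => x; rewrite inE => /= <-.
  congr EFin; apply: eq_bigr => w _; rewrite prodr_const card_ord ffunE.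
  by [].
- by move=> p n; rewrite exprn_ge0.
Qed.

(** The total of [v] is expanded over its claims. The claim singled out contributes [c], each of the
    other claims of [v] contributes [b v], and there are [N v] choices: the derivative in the
    variable of [v] appears by counting. The predecessor at 0 is harmless, as the factor [N v]
    vanishes there. *)
Lemma compound_pgf (v : V) (s c : R) (b : V -> R) : (0 <= s)%R ->
  (forall w, (0 <= b w)%R) -> (0 <= c)%R ->
  (forall w i, \int[P]_x (s ^+ C w i x)%:E = (b w)%:E) ->
  (forall i, \int[P]_x ((C v i x)%:R * s ^+ C v i x)%:E = c%:E) ->
  \int[P]_x ((compound N C v x)%:R * s ^+ aggregate N C x)%:E =
  c%:E * \int[P]_x
    ((\prod_(w | w != v) b w ^+ N w x) * ((N v x)%:R * b v ^+ (N v x).-1))%:E.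
Proof.
move=> s0 b0 c0 sb sc.
apply: (integral_fibers_proportional (Y1 := count) (Y2 := count)) => //.
- apply/measurable_EFinP; apply: measurable_funM.
    by apply: (measurable_comp_nat (fun n => n%:R)); exact: measurable_compound.
  by apply: (measurable_comp_nat (fun n => s ^+ n)%R); exact: measurable_aggregate.
- by move=> x _; rewrite lee_fin mulr_ge0// exprn_ge0.
- apply/measurable_EFinP; apply: measurable_funM; first exact: mprodN.
  exact: (measurable_comp_nat (fun n => n%:R * b v ^+ n.-1)%R).
- move=> x _; rewrite lee_fin mulr_ge0//.
    by rewrite prodr_ge0// => w _; rewrite exprn_ge0.
  by rewrite mulr_ge0// exprn_ge0.
move=> y; rewrite !setTI.
pose f (i0 : 'I_(y v)) (p : V * nat) (n : nat) : R :=
  (if p == (v, nat_of_ord i0) then n%:R * s ^+ n else s ^+ n)%R.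
pose g (i0 : 'I_(y v)) (p : V * nat) : R := (if p == (v, nat_of_ord i0) then c else b p.1)%R.
(* The factor of the claim [(v, i0)] is isolated; every other factor may be read off [h'], which
   agrees with [h] there. *)
have split1 (i0 : 'I_(y v)) (h h' : V -> nat -> R) :
   ((forall w i, (w, i) != (v, nat_of_ord i0) -> h w i = h' w i) ->
   \prod_w \prod_(i < y w) h w i = h v i0 *
    ((\prod_(i < y v | i != i0) h' v i) * \prod_(w | w != v) \prod_(i < y w) h' w i))%R.
  move=> hh; rewrite (bigD1 v)//= (bigD1 i0)//= -mulrA; congr (_ * (_ * _))%R.
    apply: eq_bigr => i ii0; apply: hh.
    by apply: contra ii0 => /eqP[] /val_inj ->.
  apply: eq_bigr => w wv; apply: eq_bigr => i _; apply: hh.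
  by apply: contra wv => /eqP/(congr1 fst) /= ->.
transitivity (\sum_(i0 < y v) \int[P]_(x in count @^-1` [set y])
     (\prod_w \prod_(i < y w) f i0 (w, nat_of_ord i) (C w i x))%:E).
  have mf i0 : measurable_fun setT (fun x =>
      (\prod_w \prod_(i < y w) f i0 (w, nat_of_ord i) (C w i x))%:E).
    apply/measurable_EFinP; apply: measurable_prod_cond => w.
    apply: measurable_prod_cond => i.
    exact: (measurable_comp_nat (f i0 (w, nat_of_ord i))).
  rewrite -ge0_integral_sum//=.
  - apply: eq_integral => x; rewrite inE => /= xy; rewrite sumEFin; congr EFin.
    have yN w : N w x = y w by rewrite -xy ffunE.
    have sE : (s ^+ aggregate N C x = \prod_w \prod_(i < y w) s ^+ C w i x)%R.
      by rewrite expr_aggregate; apply: eq_bigr => w _; rewrite yN.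
    rewrite sE /compound /random_sum natr_sum yN big_distrl /=.
    apply: eq_bigr => i0 _.
    rewrite [RHS](split1 i0 (fun w i => f i0 (w, i) (C w i x))
      (fun w i => s ^+ C w i x)%R) => [|w i wi]; last by rewrite /f (negbTE wi).
    rewrite /f eqxx -mulrA; congr (_ * _)%R.
    exact: (split1 i0 (fun w i => s ^+ C w i x)%R (fun w i => s ^+ C w i x)%R).
  - by move=> i0; exact: measurable_funTS.
  - move=> i0 x _; rewrite lee_fin; apply: prodr_ge0 => w _.
    apply: prodr_ge0 => i _; rewrite /f; case: ifP => _; rewrite ?mulr_ge0 ?exprn_ge0//.
pose K := (b v ^+ (y v).-1 * \prod_(w | w != v) b w ^+ y w)%R.
have PE : P (count @^-1` [set y]) = (fine (P (count @^-1` [set y])))%:E.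
  by rewrite fineK// fin_num_measure.
transitivity (\sum_(i0 < y v) (fine (P (count @^-1` [set y])) * (c * K))%:E).
  apply: eq_bigr => i0 _; rewrite EFinM -PE.
  rewrite (integral_count_fiber y (f := f i0) (b := g i0)).
  - congr (_ * _%:E).
    rewrite (split1 i0 (fun w i => g i0 (w, i)) (fun w i => b w)) => [|w i wi]; last first.
      by rewrite /g (negbTE wi).
    rewrite /g eqxx /K prodr_const cardC1 card_ord; congr (_ * (_ * _))%R.
    by apply: eq_bigr => w _; rewrite prodr_const card_ord.
  - by move=> p n; rewrite /f; case: ifP => _; rewrite ?mulr_ge0 ?exprn_ge0.
  - by move=> p; rewrite /f /g; case: eqP => [->|_] //=.
rewrite sumEFin sumr_const card_ord -mulr_natr.
transitivity (c%:E * (((y v)%:R * K)%:E * P (count @^-1` [set y]))).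
  by rewrite PE -!EFinM; congr EFin; rewrite fineK ?fin_num_measure//; ring.
congr (_ * _); rewrite -integral_cst//.
apply: eq_integral => x; rewrite inE => /= xy.
have yN w : y w = N w x by rewrite -xy ffunE.
rewrite /K yN (eq_bigr (fun w => b w ^+ N w x)%R) => [|w _]; last by rewrite yN.
by congr EFin; ring.
Qed.

End compound_sums.

(** * Size biasing *)

Section weighted_exponential_pgf.
Local Open Scope ereal_scope.
Context (R : realType) d (T : measurableType d) (P : {measure set T -> \bar R}).

(** By [pgf_inj] the mass of [W] on the level set of [k] is [kappa * g ^+ k / k!], and the series is
    summed from these masses. The conclusion thus reaches values of [tau] outside of (0, 1],
    including 0. *)
Lemma exponential_pgf_derivative (W : T -> R) (Z : T -> nat) (kappa g : R) :
  measurable_fun setT W -> (forall x, (0 <= W x)%R) -> measurable_fun setT Z ->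
  (0 <= kappa)%R -> (0 <= g)%R ->
  (forall tau : R, (0 < tau <= 1)%R ->
     \int[P]_x (W x * tau ^+ Z x)%:E = (kappa * expR (g * tau))%:E) ->
  forall tau : R, (0 <= tau)%R ->
    \int[P]_x (W x * ((Z x)%:R * tau ^+ (Z x).-1))%:E =
    (kappa * g * expR (g * tau))%:E.
Proof.
move=> mW W0 mZ k0 g0 H tau tau0.
have mZk k : measurable [set x | Z x = k].
  by apply: (@measurable_preimage _ _ _ _ Z [set k]).
have IW : \int[P]_x (W x)%:E = (kappa * expR (g * 1))%:E.
  rewrite -(H 1%R) ?ltr01 ?lexx//.
  by apply: eq_integral => x _; rewrite expr1n mulr1.
pose a k := fine (\int[P]_(x in [set x | Z x = k]) (W x)%:E).
have aE k : (a k)%:E = \int[P]_(x in [set x | Z x = k]) (W x)%:E.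
  rewrite fineK// ge0_fin_numE; last by apply: integral_ge0 => x _; rewrite lee_fin.
  apply: le_lt_trans (ltry (kappa * expR (g * 1))); rewrite -IW.
  apply: ge0_subset_integral => //; first exact/measurable_EFinP.
  by move=> x _; rewrite lee_fin.
have a0 k : (0 <= a k)%R.
  by rewrite -lee_fin aE; apply: integral_ge0 => x _; rewrite lee_fin.
have aS s : (0 <= s)%R ->
    \sum_(k <oo) (a k * s ^+ k)%:E = \int[P]_x (W x * s ^+ Z x)%:E.
  move=> s0; rewrite (integral_level_sets P (phi := fun k => s ^+ k)%R)//; last first.
    by move=> k; rewrite exprn_ge0.
  by apply: eq_eseriesr => k _; rewrite EFinM aE muleC.
pose b k := (kappa * (g ^+ k / k`!%:R))%R.
have bS s : (0 <= s)%R ->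
    \sum_(k <oo) (b k * s ^+ k)%:E = (kappa * expR (g * s))%:E.
  move=> s0; rewrite EFinM -nneseries_expR -nneseriesZl.
    by apply: eq_eseriesr => k _; rewrite -EFinM exprMn; congr EFin; rewrite /b; ring.
  by move=> k _; rewrite lee_fin divr_ge0// exprn_ge0// mulr_ge0.
have ab : a =1 b.
  apply: pgf_inj => //.
  - by move=> k; rewrite /b mulr_ge0// divr_ge0// exprn_ge0.
  - have := aS 1%R ler01.
    under eq_eseriesr do rewrite expr1n mulr1.
    by move=> ->; rewrite H ?ltry// ltr01 lexx.
  - by move=> s /andP[s0 s1]; rewrite aS ?(ltW s0)// bS ?(ltW s0)// H// s0.
rewrite (integral_level_sets P (phi := fun k => k%:R * tau ^+ k.-1)%R)//; last first.
  by move=> k; rewrite mulr_ge0// exprn_ge0.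
have u0 k : 0 <= (k%:R * tau ^+ k.-1)%:E *
    \int[P]_(x in [set x | Z x = k]) (W x)%:E.
  by rewrite -aE -EFinM lee_fin !mulr_ge0// exprn_ge0.
(* The term of index 0 vanishes; in the others [k + 1] cancels against [(k + 1)!], which leaves [g]
   times the exponential series. *)
rewrite nneseries_recl// mul0r mul0e add0e -nneseries_addn//.
rewrite EFinM -nneseries_expR -nneseriesZl; last first.
  by move=> k _; rewrite lee_fin divr_ge0// exprn_ge0// mulr_ge0.
apply: eq_eseriesr => k _; rewrite addn1 -aE ab -!EFinM /b /= factS natrM exprS exprMn.
congr EFin; field.
by rewrite nat1r !pnatr_eq0 -!lt0n fact_gt0.
Qed.

End weighted_exponential_pgf.

Section size_biased_mpmrf.
Local Open Scope ereal_scope.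
Context (R : realType) (V : finType) (e : rel V).
Variables (lam : V -> R) (alpha : V -> V -> R).
Hypotheses (te : is_tree e) (adm : admissible e lam alpha).
Variables (v : V) (b : V -> R).
Hypothesis b01 : forall w, (0 <= b w <= 1)%R.

Let theta := thinning_prob e lam alpha v.

(** The quotient of [eta_pgf] at the root [v] by the argument there, written without division since
    [b v] may be 0; it does not involve [b v]. *)
Definition branches : R :=
  \prod_(j | is_parent e v v j) (1 - theta j + theta j * eta_pgf e v theta b j).

Lemma branches_ge0 : (0 <= branches)%R.
Proof.
apply: prodr_ge0 => j /is_parent_neq jv.
have /andP[t0 t1] := thinning_prob_01 te adm jv.
have /andP[h0 _] := eta_pgf_01 e j b01 (thinning_prob_01 te adm (r := v)).
by rewrite addr_ge0 ?subr_ge0//; exact: mulr_ge0.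
Qed.

Let at_root (tau : R) (w : V) : R := if w == v then tau else b w.

Lemma eta_pgf_branches (t : V -> R) : (forall w, w != v -> t w = b w) ->
  eta_pgf e v theta t v = (t v * branches)%R.
Proof.
move=> tb; rewrite eta_pgfE//; congr (_ * _)%R; apply: eq_bigr => j vj.
by rewrite (eta_pgf_root_irrelevant e theta (t' := b))//; exact: is_parent_neq vj.
Qed.

(** With the other arguments fixed, the exponent is affine in the argument at [v], with slope
    [lam v * branches]. The other vertices supply the weight, [expR rest] is the constant in front,
    and the derivative is taken at [b v]. *)
Lemma mpmrf_size_biased d (T : measurableType d) (P : probability T R)
    (N : V -> {RV P >-> nat}) : is_mpmrf e lam alpha N ->
  \int[P]_x ((\prod_(w | w != v) b w ^+ N w x) *
             ((N v x)%:R * b v ^+ (N v x).-1))%:E =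
  (lam v * branches * expR (mpmrf_exponent e lam alpha v b))%:E.
Proof.
move=> Nm; have [lam0 _ _] := adm.
pose rest := (- lam v + \sum_(w | w != v) innovation_rate e lam alpha v w *
                   (eta_pgf e v theta b w - 1))%R.
have expE (t : V -> R) : (forall w, w != v -> t w = b w) ->
    mpmrf_exponent e lam alpha v t = (lam v * branches * t v + rest)%R.
  move=> tb; rewrite /mpmrf_exponent (bigD1 v)//= eta_pgf_branches//.
  rewrite (eq_bigr (fun w => innovation_rate e lam alpha v w *
                   (eta_pgf e v theta b w - 1)))%R => [|w wv]; last first.
    by rewrite (eta_pgf_root_irrelevant e theta (t' := b)).
  by rewrite /rest /innovation_rate eqxx; ring.
rewrite (exponential_pgf_derivative (kappa := expR rest) (g := lam v * branches)%R).
- by rewrite expE// [in RHS]expRD; congr EFin; ring.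
- apply: measurable_prod_cond => w.
  by apply: (measurable_comp_nat (fun n => b w ^+ n)%R); exact: measurable_funPT.
- by move=> x; apply: prodr_ge0 => w _; have /andP[? _] := b01 w; rewrite exprn_ge0.
- exact: measurable_funPT.
- exact: expR_ge0.
- by rewrite mulr_ge0 ?branches_ge0// ltW.
- move=> tau /andP[t0 t1]; rewrite -expRD addrC.
  have tb w : w != v -> at_root tau w = b w by rewrite /at_root => /negbTE ->.
  have tv : at_root tau v = tau by rewrite /at_root eqxx.
  rewrite -{2}tv -expE// -(mpmrf_pgf te adm v Nm); last first.
    by move=> w; rewrite /at_root; case: eqP => // _; rewrite (ltW t0).
  apply: eq_integral => x _; congr EFin; rewrite [RHS](bigD1 v)//= tv mulrC.
  by congr (_ * _)%R; apply: eq_bigr => w wv; rewrite tb.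
- by have /andP[] := b01 v.
Qed.

End size_biased_mpmrf.

(** * Generating functions of the claim laws *)

Section laws.
Local Open Scope ereal_scope.
Context (R : realType).

Lemma integral_same_law d (T : measurableType d) (P : probability T R)
    (X : {RV P >-> nat}) (mu : probability nat R) (f : nat -> R) :
  distribution P X =1 mu -> (forall n, (0 <= f n)%R) ->
  \int[P]_x (f (X x))%:E = \int[mu]_n (f n)%:E.
Proof.
move=> XE f0.
rewrite -(ge0_integral_distribution X (f := fun n => (f n)%:E))//.
by apply: eq_measure_integral => A _ _; exact: XE.
Qed.

Lemma integral_01 d (T : measurableType d) (P : probability T R) (f : T -> R) :
  measurable_fun setT f -> (forall x, (0 <= f x <= 1)%R) ->
  0 <= \int[P]_x (f x)%:E <= 1.
Proof.
move=> mf f01; apply/andP; split.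
  by apply: integral_ge0 => x _; rewrite lee_fin; have /andP[] := f01 x.
rewrite -[leRHS](probability_setT P) -[leRHS]mul1e -integral_cst//.
apply: ge0_le_integral => //.
- by move=> x _; rewrite lee_fin; have /andP[] := f01 x.
- exact/measurable_EFinP.
- by move=> x _; rewrite lee_fin; have /andP[] := f01 x.
Qed.

Lemma pgf_01 d (T : measurableType d) (P : probability T R) (X : T -> nat)
    (s : R) : measurable_fun setT X -> (0 <= s <= 1)%R ->
  exists2 b : R, (0 <= b <= 1)%R & \int[P]_x (s ^+ X x)%:E = b%:E.
Proof.
move=> mX s01; have /andP[s0 s1] := s01.
have /andP[i0 i1] : 0 <= \int[P]_x (s ^+ X x)%:E <= 1.
  apply: integral_01 => [|x].
    exact: (measurable_comp_nat (fun n => s ^+ n)%R).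
  by rewrite exprn_ge0// exprn_ile1.
have E : \int[P]_x (s ^+ X x)%:E = (fine (\int[P]_x (s ^+ X x)%:E))%:E.
  by rewrite fineK// ge0_fin_numE// (le_lt_trans i1)// ltry.
by exists (fine (\int[P]_x (s ^+ X x)%:E)) => //; rewrite -!lee_fin -E i0.
Qed.

(** The size-biased law is prescribed on singletons, so both sides are expanded over level sets. The
    mean cancels because it is neither 0 nor infinite. *)
Lemma size_biased_pgf d (T : measurableType d) (P : probability T R)
    (X : {RV P >-> nat}) (mu : probability nat R) (s : R) :
  size_biased mu (distribution P X) -> (0 <= s)%R -> 0 < law_mean mu < +oo ->
  law_mean mu * \int[P]_x (s ^+ X x)%:E = \int[mu]_n (n%:R * s ^+ n)%:E.
Proof.
move=> XE s0 /andP[m0 moo].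
have mE : law_mean mu = (fine (law_mean mu))%:E.
  by rewrite fineK// ge0_fin_numE// ltW.
have m0' : (0 < fine (law_mean mu))%R by rewrite -lte_fin -mE.
transitivity (law_mean mu * \int[P]_x (1 * s ^+ X x)%:E).
  by congr (_ * _); apply: eq_integral => x _; rewrite mul1r.
transitivity (\int[mu]_n (1 * (n%:R * s ^+ n))%:E); last first.
  by apply: eq_integral => x _; rewrite mul1r.
rewrite (integral_level_sets P (W := fun=> 1%R) (phi := fun k => s ^+ k)%R)//; last first.
  by move=> k; rewrite exprn_ge0.
rewrite (integral_level_sets mu (W := fun=> 1%R) (Z := fun n => n)
  (phi := fun k => k%:R * s ^+ k)%R)//; last first.
  by move=> k; rewrite mulr_ge0// exprn_ge0.
rewrite {1}mE -nneseriesZl; last first.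
  move=> k _; rewrite mule_ge0 ?lee_fin ?exprn_ge0//.
  by apply: integral_ge0 => x _; rewrite lee_fin.
apply: eq_eseriesr => k _.
rewrite !integral_cst//; last first.
  by apply: (@measurable_preimage _ _ _ _ X [set k]).
transitivity ((fine (law_mean mu))%:E * ((s ^+ k)%:E *
    ((k%:R / fine (law_mean mu))%:E * mu [set k]))).
  by congr (_ * (_ * _)); rewrite mul1e; exact: XE.
transitivity ((k%:R * s ^+ k)%:E * mu [set k]); last by rewrite mul1e.
rewrite -(fineK (fin_num_measure mu [set k] _))// -!EFinM; congr EFin.
by field; rewrite gt_eqF.
Qed.

End laws.

Section count_independence.
Local Open Scope ereal_scope.
Context (R : realType) (V : finType) d (T : measurableType d).
Variables (P : probability T R) (N : V -> T -> nat) (C : V -> nat -> T -> nat).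

Lemma sigma_vect_fiber (y : {ffun V -> nat}) :
  sigma_vect N [set x | [ffun w => N w x] = y].
Proof.
apply: (@measurable_fiber _ (g_sigma_algebraType (\bigcup_w sigma_var (N w))) V N).
move=> w _ A mA; apply: sub_sigma_algebra; exists w => //.
by rewrite setTI; exact: sigma_varE.
Qed.

(** The index type and the embedding [phi] are left free so as to cover both independence
    hypotheses, for the field and for the allocation. The conclusion is the form that compound sums
    require. *)
Lemma count_independence (I : eqType) (D : set I) (F : I -> set (set T))
    (c0 : I) (phi : V * nat -> I) :
  mutually_independent P D F -> injective phi -> (forall p, phi p != c0) ->
  D c0 -> (forall p, D (phi p)) -> F c0 = sigma_vect N ->
  (forall p, F (phi p) = sigma_var (C p.1 p.2)) ->
  forall (y : {ffun V -> nat}) (J : seq (V * nat)) (E : V * nat -> set nat),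
  uniq J ->
  P ([set x | [ffun w => N w x] = y] `&`
     \bigcap_(p in [set` J]) C p.1 p.2 @^-1` E p) =
  P [set x | [ffun w => N w x] = y] * \prod_(p <- J) P (C p.1 p.2 @^-1` E p).
Proof.
(* The empty list is set apart because a default pair [p0] is needed for [nth]. *)
move=> ind phiI phic0 Dc0 Dphi Fc0 Fphi y [|p0 J0].
  move=> E _; rewrite big_nil mule1; congr (P _).
  by apply/seteqP; split => [x []//|x ?]; split.
(* [phi] is inverted by looking up a position in the list; the default [p0] only arises off
   [c0 :: map phi J], where [A] is never evaluated. *)
move: (p0 :: J0) => J E uJ; pose A x := if x == c0 then [set x | [ffun w => N w x] = y]
  else let p := nth p0 J (index x (map phi J)) in C p.1 p.2 @^-1` E p.
have AE p : p \in J -> A (phi p) = C p.1 p.2 @^-1` E p.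
  by move=> pJ; rewrite /A (negbTE (phic0 p)) index_map// nth_index.
have Ac0 : A c0 = [set x | [ffun w => N w x] = y] by rewrite /A eqxx.
have uJ' : uniq (c0 :: map phi J).
  rewrite cons_uniq map_inj_uniq// uJ andbT.
  by apply/mapP => -[p _ /eqP]; rewrite eq_sym (negbTE (phic0 p)).
have FA i : i \in c0 :: map phi J -> D i /\ F i (A i).
  rewrite inE => /predU1P[->|/mapP[p pJ ->]].
    by rewrite Ac0 Fc0; split => //; exact: sigma_vect_fiber.
  by rewrite AE// Fphi; split => //; exact: sigma_varE.
have := ind _ A uJ' FA; rewrite big_cons big_map Ac0.
rewrite (eq_big_seq (fun p => P (C p.1 p.2 @^-1` E p))) => [<-|p pJ]; last first.
  by rewrite AE.
congr (P _); apply/seteqP; split => x /=.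
  move=> [Yx h] i /=; rewrite inE => /predU1P[->|/mapP[p pJ ->]].
    by rewrite Ac0.
  by rewrite AE//; exact: h.
move=> h; split; first by have := h c0; rewrite /= inE eqxx Ac0; apply.
by move=> p /= pJ; have := h (phi p); rewrite AE//; apply; rewrite /= inE map_f ?orbT.
Qed.

End count_independence.

Section independent_copies.
Local Open Scope ereal_scope.
Context (R : realType) d1 (T1 : measurableType d1) d2 (T2 : measurableType d2).
Variables (Q : probability T1 R) (P : probability T2 R).
Variables (K : T1 -> nat) (S : T2 -> nat).
Hypotheses (mK : measurable_fun setT K) (mS : measurable_fun setT S).

Lemma measurable_add_prod :
  measurable_fun setT (fun z : T1 * T2 => K z.1 + S z.2)%N.
Proof.
apply: measurable_fun_addn.
  exact: (measurableT_comp mK measurable_fst).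
exact: (measurableT_comp mS measurable_snd).
Qed.

Lemma product_pgf (s : R) : (0 <= s)%R ->
  \int[Q \x P]_z (s ^+ (K z.1 + S z.2))%:E =
  \int[Q]_x (s ^+ K x)%:E * \int[P]_y (s ^+ S y)%:E.
Proof.
move=> s0; rewrite fubini_tonelli1.
- rewrite /fubini_F /= -ge0_integralZr//.
  + apply: eq_integral => x _; rewrite -ge0_integralZl//.
    * by apply: eq_integral => y _; rewrite exprD EFinM.
    * apply/measurable_EFinP.
      exact: (measurable_comp_nat (fun n => s ^+ n)%R).
    * by move=> y _; rewrite lee_fin exprn_ge0.
    * by rewrite lee_fin exprn_ge0.
  + apply/measurable_EFinP.
    exact: (measurable_comp_nat (fun n => s ^+ n)%R).
  + by move=> x _; rewrite lee_fin exprn_ge0.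
  + by apply: integral_ge0 => y _; rewrite lee_fin exprn_ge0.
- apply/measurable_EFinP.
  by apply: (measurable_comp_nat (fun n => s ^+ n)%R); exact: measurable_add_prod.
- by move=> z; rewrite lee_fin exprn_ge0.
Qed.

End independent_copies.

(** * Comparison of the coefficients in [s] *)

Theorem corollary4p3 (R : realType) (d : nat)
  (e : rel 'I_d) (tree_e : is_tree e)
  (lam : 'I_d -> R) (alpha : 'I_d -> 'I_d -> R)
  (adm : admissible e lam alpha)
  (* the law of each B_v *)
  (mu : 'I_d -> probability nat R)
  (mean_mu : forall w, (0 < law_mean (mu w) < +oo)%E)
  (* the space carrying N and the B_{v,j} *)
  (dT : measure_display) (T : measurableType dT) (P : probability T R)
  (N : 'I_d -> {RV P >-> nat}) (N_mpmrf : is_mpmrf e lam alpha N)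
  (B : 'I_d -> nat -> {RV P >-> nat})
  (B_law : forall w i, distribution P (B w i) =1 mu w)
  (NB_indep : mutually_independent P [set: option ('I_d * nat)]
     (fun x => match x with
               | None => sigma_vect N
               | Some (w, i) => sigma_var (B w i)
               end))
  (v : 'I_d)
  (* the space carrying G, the B*_{v,i} and the B'_{j,i} *)
  (dU : measure_display) (U : measurableType dU) (Q : probability U R)
  (G : 'I_d -> {RV Q >-> nat})
  (G_pgf : forall t : 'I_d -> R, (forall w, -1 <= t w <= 1) ->
     joint_pgf G t = (eta_pgf e v (thinning_prob e lam alpha v) t v)%:E)
  (Bstar : nat -> {RV Q >-> nat})
  (Bstar_law : forall i, size_biased (mu v) (distribution Q (Bstar i)))
  (B' : 'I_d -> nat -> {RV Q >-> nat})
  (B'_law : forall j i, j != v -> distribution Q (B' j i) =1 mu j)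
  (GB_indep : mutually_independent Q
     [set x : unit + nat + 'I_d * nat |
        if x is inr (j, _) then j != v else true]
     (fun x => match x with
               | inl (inl _) => sigma_vect G
               | inl (inr i) => sigma_var (Bstar i)
               | inr (j, i) => sigma_var (B' j i)
               end))
  (k : nat) :
  let X := compound N B v in
  let S := aggregate N B in
  let K := allocation v G Bstar B' in
  ('E_P[fun x => ((X x)%:R * \1_[set y | S y = k] x)%R]
   = (lam v)%:E * law_mean (mu v)
     * (Q \x P) [set z : U * T | (K z.1 + S z.2)%N = k])%E.
Proof.
move=> X S K.
have [lam0 _ _] := adm.
have mmu w : law_mean (mu w) = (fine (law_mean (mu w)))%:E.
  by have /andP[m0 moo] := mean_mu w; rewrite fineK// ge0_fin_numE// ltW.
pose m := fine (law_mean (mu v)).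
have m0 : 0 < m by have /andP[+ _] := mean_mu v; rewrite mmu lte_fin.
have mN w : measurable_fun setT (N w) by exact: measurable_funPT.
have mB w i : measurable_fun setT (B w i) by exact: measurable_funPT.
have mG w : measurable_fun setT (G w) by exact: measurable_funPT.
(* With [Bstar] in place of the claims of [v], the allocation becomes an ordinary aggregate. *)
pose C (w : 'I_d) (i : nat) : {RV Q >-> nat} := if w == v then Bstar i else B' w i.
have mC w i : measurable_fun setT (C w i) by exact: measurable_funPT.
have KE : K = aggregate G (fun w i => C w i).
  apply/funext => x; rewrite /K /allocation /aggregate [RHS](bigD1 v)//=.
  congr (_ + _)%N; first by rewrite /compound /C eqxx.
  by apply: eq_bigr => w wv; rewrite /compound /C (negbTE wv).
have NB : forall (y : {ffun 'I_d -> nat}) (J : seq ('I_d * nat))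
    (E : 'I_d * nat -> set nat), uniq J ->
    (P ([set x | [ffun w => N w x] = y] `&`
      \bigcap_(p in [set` J]) B p.1 p.2 @^-1` E p) =
    P [set x | [ffun w => N w x] = y] * \prod_(p <- J) P (B p.1 p.2 @^-1` E p))%E.
  apply: (count_independence (N := fun w => N w) (C := fun w i => B w i)
    (c0 := None) (phi := Some) NB_indep) => //.
  by case.
have GC : forall (y : {ffun 'I_d -> nat}) (J : seq ('I_d * nat))
    (E : 'I_d * nat -> set nat), uniq J ->
    (Q ([set x | [ffun w => G w x] = y] `&`
      \bigcap_(p in [set` J]) C p.1 p.2 @^-1` E p) =
    Q [set x | [ffun w => G w x] = y] * \prod_(p <- J) Q (C p.1 p.2 @^-1` E p))%E.
  apply: (count_independence (N := fun w => G w) (C := fun w i => C w i)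
    (c0 := inl (inl tt)) (phi := fun p : 'I_d * nat =>
    if p.1 == v then inl (inr p.2) else inr p) GB_indep) => //.
  - move=> [w i] [w' i'] /=.
    by case: eqVneq => [->|_]; case: eqVneq => [->|_] //; [move=> [->]|move=> [-> ->]].
  - by move=> [w i] /=; case: (w == v).
  - by move=> [w i] /=; case: (eqVneq w v).
  - by move=> [w i] /=; rewrite /C; case: (eqVneq w v).
have mX : measurable_fun setT X by exact: measurable_compound.
have mS : measurable_fun setT S by exact: measurable_aggregate.
have mK : measurable_fun setT K by rewrite KE; exact: measurable_aggregate.
have X0 x : 0 <= (X x)%:R :> R by [].
have mXR : measurable_fun setT (fun x => (X x)%:R : R).
  exact: (measurable_comp_nat (fun n => n%:R)).
(* The finiteness is used at [s = 1], where it says that [X] has a finite mean: the coefficients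
   [a j] below are then finite and summable. *)
have mainE (s : R) : 0 <= s <= 1 ->
    (\int[P]_x ((X x)%:R * s ^+ S x)%:E =
     (lam v * m)%:E * \int[Q \x P]_z (s ^+ (K z.1 + S z.2))%:E)%E /\
    (\int[P]_x ((X x)%:R * s ^+ S x)%:E < +oo)%E.
  move=> s01; have /andP[s0 s1] := s01.
  have [b b01 bE] : exists2 b : 'I_d -> R, forall w, 0 <= b w <= 1 &
      forall w, (\int[mu w]_n (s ^+ n)%:E = (b w)%:E)%E.
    have ex w : exists r, 0 <= r <= 1 /\ (\int[mu w]_n (s ^+ n)%:E = r%:E)%E.
      by have [r] := pgf_01 (mu w) (X := id) (measurable_fun_nat _) s01; exists r.
    by have [b hb] := choice ex; exists b => w; have [] := hb w.
  have b0 w : 0 <= b w by have /andP[] := b01 w.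
  have BE w i : (\int[P]_x (s ^+ B w i x)%:E = (b w)%:E)%E.
    rewrite (integral_same_law (mu := mu w) (f := fun n => s ^+ n) (B_law w i))//.
    by move=> n; rewrite exprn_ge0.
  have [bs bs01 bsE] := pgf_01 Q (X := Bstar 0%N) (measurable_funPT _) s01.
  have bs0 : 0 <= bs by have /andP[] := bs01.
  have cE : (\int[mu v]_n (n%:R * s ^+ n)%:E = (m * bs)%:E)%E.
    by rewrite -(size_biased_pgf (Bstar_law 0%N) s0 (mean_mu v)) bsE mmu -EFinM.
  (* All the [Bstar i] share one generating function, since [size_biased_pgf] determines its product
     with the nonzero mean [m]. *)
  have BsE i : (\int[Q]_x (s ^+ Bstar i x)%:E = bs%:E)%E.
    have := size_biased_pgf (Bstar_law i) s0 (mean_mu v).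
    have [r _ ->] := pgf_01 Q (X := Bstar i) (measurable_funPT _) s01.
    rewrite cE mmu -EFinM => -[] /(mulfI _) -> //.
    by rewrite gt_eqF.
  pose bt w := if w == v then bs else b w.
  have bt01 w : 0 <= bt w <= 1 by rewrite /bt; case: eqP.
  have CE w i : (\int[Q]_x (s ^+ C w i x)%:E = (bt w)%:E)%E.
    rewrite /C /bt; case: eqVneq => [_|wv]; first exact: BsE.
    rewrite (integral_same_law (mu := mu w) (f := fun n => s ^+ n) (B'_law w i wv))//.
    by move=> n; rewrite exprn_ge0.
  have SE : (\int[P]_x (s ^+ S x)%:E =
      (expR (mpmrf_exponent e lam alpha v b))%:E)%E.
    by rewrite (aggregate_pgf mN mB NB s0 b0 BE) (mpmrf_pgf tree_e adm v N_mpmrf).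
  have bt0 w : 0 <= bt w by have /andP[] := bt01 w.
  have KpgfE : (\int[Q]_x (s ^+ K x)%:E = (bs * branches e lam alpha v b)%:E)%E.
    rewrite KE (aggregate_pgf mG mC GC s0 bt0 CE).
    have btN w : -1 <= bt w <= 1.
      by have /andP[? ->] := bt01 w; rewrite andbT (le_trans _ (bt0 w))// oppr_le0.
    have := G_pgf bt btN; rewrite /joint_pgf unlock => ->.
    (* [branches] ignores the argument at [v], hence may be taken at [b] instead of [bt]; the
       argument [bs] at [v] comes out as a factor. *)
    rewrite (eta_pgf_branches lam alpha tree_e (b := b)); first by rewrite /bt eqxx.
    by move=> w wv; rewrite /bt (negbTE wv).
  have XSE : (\int[P]_x ((X x)%:R * s ^+ S x)%:E = (m * bs)%:E *
      (lam v * branches e lam alpha v b *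
       expR (mpmrf_exponent e lam alpha v b))%:E)%E.
    rewrite (compound_pgf mN mB NB (c := m * bs) s0 b0 _ BE).
    - by rewrite (mpmrf_size_biased tree_e adm v b01 N_mpmrf).
    - by rewrite mulr_ge0// ltW.
    - move=> i; rewrite -cE.
      rewrite (integral_same_law (mu := mu v) (f := fun n => n%:R * s ^+ n) (B_law v i))//.
      by move=> n; rewrite mulr_ge0// exprn_ge0.
  rewrite XSE; split; last by rewrite -EFinM ltry.
  by rewrite (product_pgf Q P mK mS s0) KpgfE SE -!EFinM; congr EFin; ring.
(* [a] and the sequence [b] below are the two sides of the claim as functions of [k], made
   real-valued for [pgf_inj]. *)
pose a j : R := fine (\int[P]_(x in [set x | S x = j]) (X x)%:R%:E)%E.
have mSj j : measurable [set x | S x = j].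
  by apply: (@measurable_preimage _ _ _ _ S [set j]).
have aE j : ((a j)%:E = \int[P]_(x in [set x | S x = j]) (X x)%:R%:E)%E.
  rewrite fineK// ge0_fin_numE; last by apply: integral_ge0 => x _; rewrite lee_fin.
  have [_] := mainE 1 (introT andP (conj ler01 (lexx _))).
  apply: le_lt_trans; under [leRHS]eq_integral do rewrite expr1n mulr1.
  by apply: ge0_subset_integral => //; exact/measurable_EFinP.
pose QP := (Q \x P)%E.
have mKSj j : measurable [set z : U * T | (K z.1 + S z.2)%N = j].
  apply: (@measurable_preimage _ _ _ _ (fun z : U * T => (K z.1 + S z.2)%N) [set j]) => //.
  exact: measurable_add_prod.
pose b j : R := lam v * m * fine (QP [set z : U * T | (K z.1 + S z.2)%N = j]).
have QP1 : QP setT = 1%E.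
  rewrite -setXTT; transitivity (Q setT * P setT)%E.
    exact: product_measure1E.
  by rewrite !probability_setT mule1.
have QPE j : ((fine (QP [set z : U * T | (K z.1 + S z.2)%N = j]))%:E =
    QP [set z : U * T | (K z.1 + S z.2)%N = j])%E.
  rewrite fineK// ge0_fin_numE//; apply: (@le_lt_trans _ _ (QP setT)).
    by apply: le_measure => //; rewrite inE.
  by rewrite QP1 ltry.
have aS s : 0 <= s ->
    (\sum_(j <oo) (a j * s ^+ j)%:E = \int[P]_x ((X x)%:R * s ^+ S x)%:E)%E.
  move=> s0; rewrite (integral_level_sets P (W := fun x => (X x)%:R)
    (phi := fun j => s ^+ j))//; last by move=> j; rewrite exprn_ge0.
  by apply: eq_eseriesr => j _; rewrite EFinM aE muleC.
have bS s : 0 <= s ->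
    (\sum_(j <oo) (b j * s ^+ j)%:E =
     (lam v * m)%:E * \int[QP]_z (s ^+ (K z.1 + S z.2))%:E)%E.
  move=> s0; transitivity ((lam v * m)%:E *
      \int[QP]_z (1 * s ^+ (K z.1 + S z.2))%:E)%E; last first.
    by congr (_ * _)%E; apply: eq_integral => z _; rewrite mul1r.
  rewrite (integral_level_sets QP (W := fun=> 1)
    (Z := fun z : U * T => (K z.1 + S z.2)%N) (phi := fun j => s ^+ j))//; last 2 first.
  - exact: measurable_add_prod.
  - by move=> j; rewrite exprn_ge0.
  rewrite -nneseriesZl; last first.
    move=> j _; rewrite mule_ge0 ?lee_fin ?exprn_ge0//.
    by apply: integral_ge0 => z _; rewrite lee_fin.
  apply: eq_eseriesr => j _; transitivity ((lam v * m)%:E *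
      ((s ^+ j)%:E * QP [set z : U * T | (K z.1 + S z.2)%N = j]))%E; last first.
    by rewrite integral_cst// mul1e.
  by rewrite -QPE -!EFinM; congr EFin; rewrite /b; ring.
have ab : a =1 b.
  apply: pgf_inj.
  - by move=> j; rewrite -lee_fin aE; apply: integral_ge0 => x _; rewrite lee_fin.
  - by move=> j; rewrite /b !mulr_ge0 ?(ltW (lam0 v)) ?(ltW m0)// fine_ge0.
  - have := aS 1 ler01; under eq_eseriesr do rewrite expr1n mulr1.
    by move=> ->; have [] := mainE 1 (introT andP (conj ler01 (lexx _))).
  - move=> s /andP[s0 s1]; rewrite aS ?(ltW s0)// bS ?(ltW s0)//.
    by have [] := mainE s; rewrite ?(ltW s0).
transitivity ((a k)%:E).
  rewrite unlock aE [RHS]integral_mkcond; apply: eq_integral => x _.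
  rewrite patchE indicE; case: ifP => _; rewrite ?mulr1 ?mulr0//.
by rewrite ab /b EFinM QPE EFinM mmu.
Qed.
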